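(* Let $(\Gamma,v)$ be an admissible pair with $\Gamma=(\gamma_n)$ a subset of the real line, and let $\alpha$ be a real number. Then the discrete Hilbert transform $$H_v(\Gamma,\Lambda(\alpha)):\ \ell^2_v\to\ell^2_{w(\alpha)},\qquad (a_n)_n\mapsto\Big(\sum_n\frac{a_nv_n}{\lambda_j-\gamma_n}\Big)_j,$$ where $\Lambda(\alpha)=(\lambda_j)$, is unitary if and only if the function $z\mapsto(\alpha-\varphi(z))^{-1}$ is a purely atomic Herglotz function (in the upper half-plane).
   Context: $\Gamma=(\gamma_n)$ is a finite or infinite sequence of distinct points and $v=(v_n)$ a sequence of positive numbers with the same index set. The pair $(\Gamma,v)$ is called admissible if $\sum_n\frac{v_n}{1+|\gamma_n|^2}<\infty$. Set $$(\Gamma,v)^*=\Big\{z\in\mathbb{C}:\ \sum_n\frac{v_n}{|z-\gamma_n|^2}<\infty\Big\},$$ where points of $\Gamma$ are understood not to belong to $(\Gamma,v)^*$. For an admissible pair with $\Gamma\subset\mathbb{R}$ define, for $z\in(\Gamma,v)^*$, $$\varphi(z)=\sum_n v_n\Big(\frac{1}{\gamma_n-z}-\frac{\gamma_n}{1+\gamma_n^2}\Big);$$ this series converges absolutely on $(\Gamma,v)^*$, and $(\Gamma,v)^*$ contains the open upper half-plane. For real $\alpha$ set $$\Lambda(\alpha)=\{\lambda\in(\Gamma,v)^*:\ \varphi(\lambda)=\alpha\}.$$ This set is at most countable and consists of real points; it is enumerated as $\Lambda(\alpha)=(\lambda_j)$. The associated weight sequence $w(\alpha)=(w_j)$ is $$w_j=\Big(\sum_n\frac{v_n}{(\lambda_j-\gamma_n)^2}\Big)^{-1}.$$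 For positive weights $v=(v_n)$, $\ell^2_v$ is the Hilbert space of complex sequences $(a_n)$ with $\sum_n|a_n|^2v_n<\infty$; $\ell^2_{w(\alpha)}$ is defined likewise (it is $\{0\}$ if $\Lambda(\alpha)$ is empty). ''Unitary'' means that the map takes $\ell^2_v$ into $\ell^2_{w(\alpha)}$ and is a surjective linear isometry. A Herglotz function in the upper half-plane is a holomorphic function $\psi$ there whose imaginary part is positive; it can be written as $$\psi(z)=b+cz+\int_{-\infty}^{\infty}\Big(\frac{1}{t-z}-\frac{t}{1+t^2}\Big)\,d\mu(t),$$ where $b$ is a real constant, $c\ge0$ is a constant, and $\mu$ is a nonnegative measure on the real line with $\int_{-\infty}^\infty\frac{d\mu(t)}{1+t^2}<\infty$. The Herglotz function $\psi$ is called purely atomic if $c=0$ and $\mu$ is a purely atomic measure. *)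

(* Defs.v *)
From HB Require Import structures.
From mathcomp Require Import all_boot all_order all_algebra.
From mathcomp Require Import all_classical all_reals all_analysis.
From mathcomp.real_closed Require Export complex.
Set Implicit Arguments.
Unset Strict Implicit.
Unset Printing Implicit Defensive.
Import Order.TTheory GRing.Theory Num.Theory.
Import numFieldNormedType.Exports.
Local Open Scope classical_set_scope.
Local Open Scope ring_scope.
Local Open Scope complex_scope.

(* Sequences are families over an arbitrary index type: a [countType] for the
   points gamma_n, and the set Lambda(alpha) itself for its own elements.  All
   sums are unordered; [fsum] and [csum] are meaningful on absolutely summable
   families, where they agree with the sum in any enumeration. *)

Section sums.
Context {R : realType} {I : choiceType}.

Definition fsum (f : I -> R) : R :=
  fine (\esum_(i in [set: I]) (f^\+ i)%:E)
  - fine (\esum_(i in [set: I]) (f^\- i)%:E).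

Definition csum (f : I -> R[i]) : R[i] :=
  fsum (fun i => complex.Re (f i)) +i* fsum (fun i => complex.Im (f i)).

End sums.

Section weighted_l2.
Context {R : realType}.

Definition l2 (I : choiceType) (w : I -> R) : set (I -> R[i]) :=
  [set a | (\esum_(i in [set: I]) (Normc.normc (a i) ^+ 2 * w i)%:E < +oo)%E].

Definition l2norm (I : choiceType) (w : I -> R) (a : I -> R[i]) : R :=
  Num.sqrt (fine (\esum_(i in [set: I]) (Normc.normc (a i) ^+ 2 * w i)%:E)).

Definition unitary (I J : choiceType) (v : I -> R) (w : J -> R)
    (T : (I -> R[i]) -> (J -> R[i])) : Prop :=
  [/\ forall a, l2 v a -> l2 w (T a),
      forall (k : R[i]) a b, l2 v a -> l2 v b ->
        T (fun i => k * a i + b i) = (fun j => k * T a j + T b j),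
      forall a, l2 v a -> l2norm w (T a) = l2norm v a
    & forall b, l2 w b -> exists2 a, l2 v a & T a = b].

End weighted_l2.

Section discrete_hilbert.
Context {R : realType} {I : countType}.
Variables (gamma : I -> R[i]) (v : I -> R).

Definition admissible : Prop :=
  [/\ injective gamma,
      forall n, 0 < v n
    & (\esum_(n in [set: I])
         (v n / (1 + Normc.normc (gamma n) ^+ 2))%:E < +oo)%E].

Definition star : set R[i] :=
  [set z | (forall n, z != gamma n) /\
           (\esum_(n in [set: I])
              (v n / Normc.normc (z - gamma n) ^+ 2)%:E < +oo)%E].

Definition phi (z : R[i]) : R[i] :=
  csum (fun n => (v n)%:C *
    ((gamma n - z)^-1 - gamma n / (1 + gamma n ^+ 2))).

Definition Lambda (alpha : R) : set R[i] :=
  [set l | star l /\ phi l = alpha%:C].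

(* The sum is real (and positive) at the points of Lambda(alpha), which are
   real when gamma is; [complex.Re] only casts it to R. *)
Definition weight (l : R[i]) : R :=
  (complex.Re (csum (fun n => (v n)%:C / (l - gamma n) ^+ 2)))^-1.

Definition dht (L : set R[i]) (a : I -> R[i]) : L -> R[i] :=
  fun l => csum (fun n => a n * (v n)%:C / (\val l - gamma n)).

End discrete_hilbert.

Section herglotz.
Context {R : realType}.

Definition upper : set R[i] := [set z | 0 < complex.Im z].

(* Derivability over the field R[i] in the direction 1 is complex
   differentiability. *)
Definition herglotz (psi : R[i] -> R[i]) : Prop :=
  (forall z, upper z -> derivable (psi : R[i]^o -> R[i]^o) z 1) /\
  (forall z, upper z -> 0 < complex.Im (psi z)).

Definition cintegral (mu : {measure set (measurableTypeR R) -> \bar R})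
    (f : R -> R[i]) : R[i] :=
  (\int[mu]_t complex.Re (f t)) +i* (\int[mu]_t complex.Im (f t)).

Definition herglotz_repr (psi : R[i] -> R[i]) (b c : R)
    (mu : {measure set (measurableTypeR R) -> \bar R}) : Prop :=
  [/\ 0 <= c,
      (\int[mu]_t ((1 + t ^+ 2)^-1)%:E < +oo)%E
    & forall z, upper z ->
        psi z = b%:C + c%:C * z +
          cintegral mu (fun t => (t%:C - z)^-1 - (t / (1 + t ^+ 2))%:C)].

Definition purely_atomic_measure
    (mu : {measure set (measurableTypeR R) -> \bar R}) : Prop :=
  exists2 A : set R, countable A & mu (~` A) = 0%E.

(* b, c and mu are determined by psi. *)
Definition purely_atomic_herglotz (psi : R[i] -> R[i]) : Prop :=
  herglotz psi /\
  exists (b c : R) (mu : {measure set (measurableTypeR R) -> \bar R}),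
    [/\ herglotz_repr psi b c mu, c = 0 & purely_atomic_measure mu].

End herglotz.

(* Main.v *)
From HB Require Import structures.
From mathcomp Require Import all_boot all_order all_algebra.
From mathcomp Require Import all_classical all_reals all_analysis measurable_realfun.
From mathcomp Require Import ring lra.
Require Import Defs.
Set Implicit Arguments.
Unset Strict Implicit.
Unset Printing Implicit Defensive.
Import Order.TTheory GRing.Theory Num.Theory.
Import numFieldNormedType.Exports.
Local Open Scope classical_set_scope.
Local Open Scope ring_scope.
Local Open Scope complex_scope.

(* For l in Lambda(alpha) let e_l be the real vector (1 / (l - gamma_n))_n.  The
   resolvent identity
     phi(z) - phi(u) = (z - u) sum_n v_n / ((gamma_n - z) (gamma_n - u))
   shows that the e_l are pairwise orthogonal in l2_v with |e_l|^2 = 1 / w_l, so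
   the transform, a |-> <a, e_l>, is always a coisometry, and it is unitary iff
   Parseval's identity holds.  By the same identity it sends the kernel
   k_z = (1 / (gamma_n - z))_n to (alpha - phi(z)) / (z - l).

   If Parseval holds, comparing <k_z, k_(-i)> with its image expands
   psi = 1 / (alpha - phi) over the measure sum_l w_l delta_l.  Conversely, if psi
   is represented by an atomic measure mu, an atom of mass m at t forces
   |alpha - phi(t + iy)| <= y / m, hence t in Lambda(alpha) and m <= w_t.  Then
   Im psi(z) <= sum_l w_l Im z / |l - z|^2, which is Parseval for k_z, and the
   point masses are limits of the vectors y Im k_(gamma_n + iy). *)

(** * Unordered sums of real families *)

(** Since [gamma] and the points of Lambda(alpha) are real, the e_l are real vectors and the
    transform acts separately on real and imaginary parts, so the Hilbert space arguments run over
    real sequences. Failure of Parseval is measured by [defect], the squared distance to the closed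
    span of the e_l. On kernels both sides of Parseval are explicit: Im psi(z) = Im z |k_z|^2 /
    |alpha - phi(z)|^2, and the image of k_z has square norm |alpha - phi(z)|^2 sum_l w_l / |z -
    l|^2. The upper bound on Im psi(z) therefore says that the transform does not shrink k_z, which
    is the reverse of Bessel. The assumption c = 0 enters there: otherwise c Im z would have to be
    added to the bound. The inequality m <= w_t is the limit y -> 0 of sum_n v_n / ((gamma_n - t)^2
    + y^2) <= 1 / m, which is the imaginary part of the estimate on alpha - phi. *)

Section real_families.
Context {R : realType} {I : choiceType}.
Implicit Types (f g : I -> R) (s : seq I).

Definition rsummable f := (\esum_(i in [set: I]) `|f i|%:E < +oo)%E.

Lemma sum_le_esum (a : I -> \bar R) s : (forall i, 0 <= a i)%E -> uniq s ->
  (\sum_(i <- s) a i <= \esum_(i in [set: I]) a i)%E.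
Proof.
move=> a0 us; apply: esum_ge; exists [set` s]; first by split.
by rewrite -fsbig_seq.
Qed.

Lemma esum_le_bound (a : I -> \bar R) M :
  (forall s, uniq s -> \sum_(i <- s) a i <= M)%E ->
  (\esum_(i in [set: I]) a i <= M)%E.
Proof.
move=> aM; apply: ge_ereal_sup => _ [X [finX _] <-].
by rewrite fsbig_finite// aM.
Qed.

Lemma rsummable_le f g : (forall i, `|f i| <= g i) ->
  (\esum_(i in [set: I]) (g i)%:E < +oo)%E -> rsummable f.
Proof.
move=> fg; apply: le_lt_trans; apply: le_esum => i _; rewrite lee_fin; exact: fg.
Qed.

Lemma ge0_rsummable f : (forall i, 0 <= f i) ->
  rsummable f = (\esum_(i in [set: I]) (f i)%:E < +oo)%E.
Proof.
move=> f0; rewrite /rsummable; congr (_ < _)%E.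
by apply: eq_esum => i _; rewrite ger0_norm.
Qed.

Lemma rsummable_dom f g : (forall i, `|f i| <= g i) -> rsummable g -> rsummable f.
Proof.
move=> fg; have g0 i : 0 <= g i by exact: le_trans (fg i).
by rewrite (ge0_rsummable g0); exact: rsummable_le.
Qed.

Lemma esum_fin_num f : (forall i, 0 <= f i) -> rsummable f ->
  (\esum_(i in [set: I]) (f i)%:E)%E \is a fin_num.
Proof.
move=> f0; rewrite ge0_rsummable// => fs; rewrite ge0_fin_numE//.
by apply: esum_ge0 => i _; rewrite lee_fin.
Qed.

(** The value of [fsum] does not depend on how the family is split into nonnegative parts:
    [f^\+ + w = f^\- + u] is an identity between nonnegative families, where [esum] is additive.
    Additivity of [fsum] rests on this freedom. *)
Lemma fsum_sub f u w : (forall i, 0 <= u i) -> (forall i, 0 <= w i) ->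
  rsummable u -> rsummable w -> (forall i, f i = u i - w i) ->
  fsum f = fine (\esum_(i in [set: I]) (u i)%:E)
           - fine (\esum_(i in [set: I]) (w i)%:E).
Proof.
move=> u0 w0 us ws fE.
have p0 i : 0 <= f^\+ i by exact: funrpos_ge0.
have n0 i : 0 <= f^\- i by exact: funrneg_ge0.
have ps : rsummable (f^\+).
  apply: (rsummable_dom _ us) => i; rewrite ger0_norm//.
  by rewrite /funrpos ge_max fE u0 lerBlDr lerDl w0.
have ns : rsummable (f^\-).
  apply: (rsummable_dom _ ws) => i; rewrite ger0_norm//.
  by rewrite /funrneg ge_max fE w0 opprB lerBlDr lerDl u0.
have D a b : (forall i, 0 <= a i) -> (forall i, 0 <= b i) -> rsummable a ->
    rsummable b -> fine (\esum_(i in [set: I]) (a i + b i)%:E) =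
    fine (\esum_(i in [set: I]) (a i)%:E) + fine (\esum_(i in [set: I]) (b i)%:E).
  move=> a0 b0 sa sb; rewrite -fineD ?esum_fin_num// -esumD//; last first.
  - by move=> i _; rewrite lee_fin.
  - by move=> i _; rewrite lee_fin.
have : (fun i => (f^\+ i + w i)%:E) = (fun i => (f^\- i + u i)%:E).
  apply/funext => i; congr EFin.
  have : f^\+ i - f^\- i = f i := congr1 (@^~ i) (funrposBneg f).
  by rewrite fE; lra.
move=> /(congr1 (fun h => fine (esum [set: I] h))).
rewrite (D _ _ p0 w0 ps ws) (D _ _ n0 u0 ns us) /fsum.
by move: (fine _) (fine _) (fine _) (fine _) => a b c d; lra.
Qed.

Lemma fsum_ge0E f : (forall i, 0 <= f i) -> rsummable f ->
  (fsum f)%:E = (\esum_(i in [set: I]) (f i)%:E)%E.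
Proof.
move=> f0 fs; have z0 : \esum_(i in [set: I]) ((fun=> 0) i : R)%:E = 0%E.
  by apply: esum1.
rewrite (@fsum_sub f f (fun=> 0)) ?z0//= ?subr0 ?fineK ?esum_fin_num//.
- by rewrite ge0_rsummable// z0.
- by move=> i; rewrite subr0.
Qed.

Lemma rsummable_abs f : rsummable f -> rsummable (fun i => `|f i|).
Proof.
by apply: le_lt_trans; apply: le_esum => i _; rewrite normr_id.
Qed.

Lemma rsummable0 : rsummable (fun=> 0).
Proof. by rewrite /rsummable esum1// => i _; rewrite normr0. Qed.

Lemma rsummableD f g : rsummable f -> rsummable g ->
  rsummable (fun i => f i + g i).
Proof.
move=> fs gs; apply: (@rsummable_le _ (fun i => `|f i| + `|g i|)).
  by move=> i; exact: ler_normD.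
by under eq_esum do rewrite EFinD; rewrite esumD//; exact: lte_add_pinfty.
Qed.

Lemma ge0_rsummable_bound f M : (forall i, 0 <= f i) ->
  (forall s, uniq s -> \sum_(i <- s) f i <= M) ->
  rsummable f /\ fsum f <= M.
Proof.
move=> f0 fM; have le : (\esum_(i in [set: I]) (f i)%:E <= M%:E)%E.
  by apply: esum_le_bound => s us; rewrite sumEFin lee_fin fM.
have fs : rsummable f by rewrite ge0_rsummable// (le_lt_trans le)// ltry.
by split=> //; rewrite -lee_fin fsum_ge0E.
Qed.

Lemma sum_le_fsum f s : (forall i, 0 <= f i) -> rsummable f -> uniq s ->
  \sum_(i <- s) f i <= fsum f.
Proof.
by move=> f0 fs us; rewrite -lee_fin fsum_ge0E// -sumEFin sum_le_esum.
Qed.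

Lemma le_fsum_term f i : (forall i, 0 <= f i) -> rsummable f -> f i <= fsum f.
Proof.
by move=> f0 fs; have := sum_le_fsum f0 fs (s := [:: i]); rewrite big_seq1; apply.
Qed.

Lemma rsummableZ k f : rsummable f -> rsummable (fun i => k * f i).
Proof.
move=> /rsummable_abs fs.
have [//|ks _] := @ge0_rsummable_bound (fun i => `|k * f i|)
    (`|k| * fsum (fun i => `|f i|)) (fun i => normr_ge0 _) _.
  move=> s us; under eq_bigr do rewrite normrM.
  by rewrite -mulr_sumr ler_wpM2l// sum_le_fsum.
by apply: rsummable_dom ks.
Qed.

Lemma rsummableN f : rsummable f -> rsummable (fun i => - f i).
Proof. by move=> /rsummable_abs; apply: rsummable_dom => i; rewrite normrN. Qed.

Lemma rsummable_pos f : rsummable f -> rsummable (f^\+).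
Proof.
move=> /rsummable_abs; apply: rsummable_dom => i.
by rewrite ger0_norm ?funrpos_ge0// /funrpos ge_max normr_ge0 ler_norm.
Qed.

Lemma rsummable_neg f : rsummable f -> rsummable (f^\-).
Proof.
move=> /rsummable_abs; apply: rsummable_dom => i.
by rewrite ger0_norm ?funrneg_ge0// /funrneg ge_max normr_ge0 -normrN ler_norm.
Qed.

Lemma fsumE f : rsummable f -> fsum f = fsum (f^\+) - fsum (f^\-).
Proof.
move=> fs.
have p := fsum_ge0E (@funrpos_ge0 _ _ f) (rsummable_pos fs).
have n := fsum_ge0E (@funrneg_ge0 _ _ f) (rsummable_neg fs).
by rewrite {1}/fsum -p -n.
Qed.

Lemma fsum_diff f u w : (forall i, 0 <= u i) -> (forall i, 0 <= w i) ->
  rsummable u -> rsummable w -> (forall i, f i = u i - w i) ->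
  fsum f = fsum u - fsum w.
Proof.
move=> u0 w0 us ws fE; rewrite (fsum_sub u0 w0 us ws fE).
by rewrite -!fsum_ge0E.
Qed.

Lemma ge0_fsumD f g : (forall i, 0 <= f i) -> (forall i, 0 <= g i) ->
  rsummable f -> rsummable g -> fsum (fun i => f i + g i) = fsum f + fsum g.
Proof.
move=> f0 g0 fs gs; apply: EFin_inj.
rewrite [RHS]EFinD (fsum_ge0E f0 fs) (fsum_ge0E g0 gs).
rewrite fsum_ge0E.
- by rewrite -esumD//; move=> i _; rewrite lee_fin.
- by move=> i; rewrite addr_ge0.
- exact: rsummableD.
Qed.

Lemma fsumD f g : rsummable f -> rsummable g ->
  fsum (fun i => f i + g i) = fsum f + fsum g.
Proof.
move=> fs gs.
have [fp fn] := (rsummable_pos fs, rsummable_neg fs).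
have [gp gn] := (rsummable_pos gs, rsummable_neg gs).
rewrite (@fsum_diff _ (fun i => f^\+ i + g^\+ i) (fun i => f^\- i + g^\- i)).
- by rewrite !ge0_fsumD//; rewrite (fsumE fs) (fsumE gs); lra.
- by move=> i; rewrite addr_ge0// funrpos_ge0.
- by move=> i; rewrite addr_ge0// funrneg_ge0.
- exact: rsummableD.
- exact: rsummableD.
- move=> i; have : f^\+ i - f^\- i = f i := congr1 (@^~ i) (funrposBneg f).
  have : g^\+ i - g^\- i = g i := congr1 (@^~ i) (funrposBneg g).
  by lra.
Qed.

Lemma fsum0 : fsum (fun _ : I => 0 : R) = 0.
Proof. by apply: EFin_inj; rewrite fsum_ge0E ?esum1//; exact: rsummable0. Qed.

Lemma fsumN f : rsummable f -> fsum (fun i => - f i) = - fsum f.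
Proof.
move=> fs; have := fsumD fs (rsummableN fs).
have -> : (fun i => f i - f i) = (fun=> 0) by apply/funext => i; rewrite subrr.
by rewrite fsum0 => /esym/eqP; rewrite addr_eq0 => /eqP ->; rewrite opprK.
Qed.

Lemma fsumB f g : rsummable f -> rsummable g ->
  fsum (fun i => f i - g i) = fsum f - fsum g.
Proof. by move=> fs gs; rewrite fsumD ?fsumN//; exact: rsummableN. Qed.

Lemma fsum_ge0 f : (forall i, 0 <= f i) -> 0 <= fsum f.
Proof.
move=> f0; rewrite /fsum.
rewrite [X in _ - fine X]esum1 ?subr0.
  by apply/fine_ge0/esum_ge0 => i _; rewrite lee_fin funrpos_ge0.
by move=> i _; rewrite /funrneg max_r// oppr_le0.
Qed.

Lemma le_fsum f g : rsummable f -> rsummable g -> (forall i, f i <= g i) ->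
  fsum f <= fsum g.
Proof.
by move=> fs gs fg; rewrite -subr_ge0 -fsumB//; apply: fsum_ge0 => i; rewrite subr_ge0.
Qed.

Lemma ler_norm_fsum f : rsummable f -> `|fsum f| <= fsum (fun i => `|f i|).
Proof.
move=> fs; have fa := rsummable_abs fs.
rewrite ler_norml -fsumN//; apply/andP; split; apply: le_fsum => //.
- exact: rsummableN.
- by move=> i; rewrite lerNl -normrN ler_norm.
- by move=> i; rewrite ler_norm.
Qed.

Lemma fsumZ k f : rsummable f -> fsum (fun i => k * f i) = k * fsum f.
Proof.
wlog k0 : k / 0 <= k => [hw fs|fs].
  have [/hw-> //|/ltW] := leP 0 k; rewrite -oppr_ge0 => /hw/(_ fs).
  rewrite mulNr (_ : (fun i => _) = (fun i => - (k * f i))).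
    by rewrite fsumN => [/oppr_inj //|]; exact: rsummableZ.
  by apply/funext => i; rewrite mulNr.
wlog f0 : f fs / forall i, 0 <= f i => [hw|].
  have [fp fn] := (rsummable_pos fs, rsummable_neg fs).
  rewrite (fsumE fs) mulrBr -(hw _ fp (@funrpos_ge0 _ _ f)) -(hw _ fn (@funrneg_ge0 _ _ f)).
  apply: fsum_diff; [| |exact: rsummableZ|exact: rsummableZ|].
  - by move=> i; rewrite mulr_ge0// funrpos_ge0.
  - by move=> i; rewrite mulr_ge0// funrneg_ge0.
  - by move=> i; rewrite -mulrBr; congr (_ * _); exact/esym/(congr1 (@^~ i) (funrposBneg f)).
(* One inequality for every nonnegative factor is enough: applied to [k^-1] and the family [k * f]
   it gives the reverse one. *)
have hle (c : R) (h : I -> R) : 0 <= c -> (forall i, 0 <= h i) -> rsummable h ->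
    fsum (fun i => c * h i) <= c * fsum h.
  move=> c0 h0 hs; have [|s us|//] := @ge0_rsummable_bound (fun i => c * h i) (c * fsum h).
    by move=> i; rewrite mulr_ge0.
  by rewrite -mulr_sumr ler_wpM2l// sum_le_fsum.
apply/eqP; rewrite eq_le hle//=.
have [->|kn0] := eqVneq k 0; first by rewrite mul0r fsum_ge0// => i; rewrite mul0r.
have {}k0 : 0 < k by rewrite lt_def kn0.
rewrite -ler_pdivlMl//.
have fE : (fun i => k^-1 * (k * f i)) = f by apply/funext => i; rewrite mulKf.
rewrite -[X in fsum X <= _]fE; apply: (hle k^-1 (fun i => k * f i)).
- by rewrite invr_ge0 ltW.
- by move=> i; rewrite mulr_ge0// ltW.
- exact: rsummableZ.
Qed.

Lemma fsum_seq s f : uniq s ->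
  rsummable (fun i => if i \in s then f i else 0) /\
  fsum (fun i => if i \in s then f i else 0) = \sum_(i <- s) f i.
Proof.
move=> us.
have hs g : (forall i, 0 <= g i) ->
    \esum_(i in [set: I]) (if i \in s then g i else 0)%:E = (\sum_(i <- s) g i)%:E.
  move=> g0; rewrite -sumEFin fsbig_seq//= -esum_fset//; last first.
    by move=> i _; rewrite lee_fin.
  rewrite [RHS]esum_mkcond; apply: eq_esum => i _; rewrite (fun_if EFin).
  by rewrite mem_setE.
have rs g : (forall i, 0 <= g i) -> rsummable (fun i => if i \in s then g i else 0).
  by move=> g0; rewrite ge0_rsummable ?hs ?ltry// => i; case: ifP.
split.
  apply: rsummable_dom (rs _ (fun i => normr_ge0 (f i))) => i.
  by case: ifP; rewrite ?normr0.
have hf g : (forall i, 0 <= g i) ->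
    fsum (fun i => if i \in s then g i else 0) = \sum_(i <- s) g i.
  by move=> g0; apply: EFin_inj; rewrite fsum_ge0E ?hs//; [move=> i; case: ifP|exact: rs].
rewrite (@fsum_diff _ (fun i => if i \in s then f^\+ i else 0)
  (fun i => if i \in s then f^\- i else 0)).
- rewrite !hf -?sumrB; [|exact: funrneg_ge0|exact: funrpos_ge0].
  by apply: eq_bigr => i _; exact: (congr1 (@^~ i) (funrposBneg f)).
- by move=> i; case: ifP => // _; exact: funrpos_ge0.
- by move=> i; case: ifP => // _; exact: funrneg_ge0.
- by apply: rs; exact: funrpos_ge0.
- by apply: rs; exact: funrneg_ge0.
- move=> i; case: ifP => _; last by rewrite subr0.
  exact/esym/(congr1 (@^~ i) (funrposBneg f)).
Qed.

Lemma fsum_tail f (e : R) : rsummable f -> 0 < e ->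
  exists2 s, uniq s & fsum (fun i => if i \in s then 0 else `|f i|) <= e.
Proof.
move=> /rsummable_abs fs e0.
have : ((fsum (fun i => `|f i|) - e)%:E < \esum_(i in [set: I]) `|f i|%:E)%E.
  by rewrite -fsum_ge0E// lte_fin ltrBlDr ltrDl.
move=> /ereal_sup_gt[_ [X [finX _] <-]].
rewrite fsbig_finite//= sumEFin lte_fin => /ltW le.
have := finmap.fset_uniq (fset_set X); move: (finmap.enum_fset _) le => s le us.
exists s => //; have [rs] := fsum_seq (fun i => `|f i|) us.
move: le => /[swap] <- le.
rewrite (_ : (fun i => _) = (fun i => `|f i| - (if i \in s then `|f i| else 0))); last first.
  by apply/funext => i; case: ifP; rewrite ?subrr ?subr0.
by rewrite fsumB//; lra.
Qed.

End real_families.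

(** * Orthogonal families in weighted l2 spaces *)

Section weighted_inner_product.
Context {R : realType} {I : choiceType}.
Variable v : I -> R.
Hypothesis v0 : forall n, 0 <= v n.
Implicit Types (a b c : I -> R) (s : seq I).

Definition ip a b := fsum (fun n => a n * b n * v n).
Definition rl2 a := rsummable (fun n => a n * a n * v n).

Lemma ipC a b : ip a b = ip b a.
Proof. by congr fsum; apply/funext => n; rewrite (mulrC (a n)). Qed.

Lemma ip_ge0 a : 0 <= ip a a.
Proof. by apply: fsum_ge0 => n; rewrite mulr_ge0// -expr2 sqr_ge0. Qed.

Lemma ip_summable a b : rl2 a -> rl2 b -> rsummable (fun n => a n * b n * v n).
Proof.
move=> la lb; apply: rsummable_dom (rsummableD la lb) => n.
rewrite normrM (ger0_norm (v0 n)) -mulrDl ler_wpM2r//.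
by rewrite ler_norml; apply/andP; split; nra.
Qed.

Lemma rl2Z k a : rl2 a -> rl2 (fun n => k * a n).
Proof.
move=> /(@rsummableZ _ _ (k * k)); congr rsummable.
by apply/funext => n; ring.
Qed.

Lemma rl2D a b : rl2 a -> rl2 b -> rl2 (fun n => a n + b n).
Proof.
move=> la lb; have lab := ip_summable la lb.
move: (rsummableD (rsummableD la lb) (rsummableZ 2 lab)); congr rsummable.
by apply/funext => n; ring.
Qed.

Lemma ipZl k a b : rl2 a -> rl2 b -> ip (fun n => k * a n) b = k * ip a b.
Proof.
move=> la lb; rewrite -fsumZ; last exact: ip_summable.
by congr fsum; apply/funext => n; ring.
Qed.

Lemma ipDl a b c : rl2 a -> rl2 b -> rl2 c ->
  ip (fun n => a n + b n) c = ip a c + ip b c.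
Proof.
move=> la lb lc; rewrite -fsumD; [|exact: ip_summable..].
by congr fsum; apply/funext => n; ring.
Qed.

Lemma ipDr a b c : rl2 a -> rl2 b -> rl2 c ->
  ip c (fun n => a n + b n) = ip c a + ip c b.
Proof. by move=> la lb lc; rewrite ipC ipDl// !(ipC c). Qed.

Lemma ipZr k a b : rl2 a -> rl2 b -> ip a (fun n => k * b n) = k * ip a b.
Proof. by move=> la lb; rewrite ipC ipZl// (ipC a). Qed.

Lemma ipDD a b : rl2 a -> rl2 b ->
  ip (fun n => a n + b n) (fun n => a n + b n) = ip a a + 2 * ip a b + ip b b.
Proof.
move=> la lb; have lab := rl2D la lb.
rewrite (ipDl la lb lab) (ipDr la lb la) (ipDr la lb lb) (ipC b a); ring.
Qed.

Lemma ipBB a b : rl2 a -> rl2 b ->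
  ip (fun n => a n - b n) (fun n => a n - b n) = ip a a - 2 * ip a b + ip b b.
Proof.
move=> la lb; have lN := rl2Z (-1) lb.
have -> : (fun n => a n - b n) = (fun n => a n + -1 * b n).
  by apply/funext => n; rewrite mulN1r.
rewrite (ipDD la lN) (ipZr _ la lb) (ipZl _ lb lN) (ipZr _ lb lb); ring.
Qed.

Lemma rl2B a b : rl2 a -> rl2 b -> rl2 (fun n => a n - b n).
Proof.
move=> la lb; have := rl2D la (rl2Z (-1) lb).
by congr rl2; apply/funext => n; rewrite mulN1r.
Qed.

Lemma ipBl a b c : rl2 a -> rl2 b -> rl2 c ->
  ip (fun n => a n - b n) c = ip a c - ip b c.
Proof.
move=> la lb lc; rewrite -fsumB; [|exact: ip_summable..].
by congr fsum; apply/funext => n; ring.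
Qed.

Lemma ip_young a b : rl2 a -> rl2 b -> 2 * ip a b <= ip a a + ip b b.
Proof.
by move=> la lb; have := ip_ge0 (fun n => a n - b n); rewrite ipBB//; lra.
Qed.

Lemma cauchy_schwarz a b : rl2 a -> rl2 b -> ip a b ^+ 2 <= ip a a * ip b b.
Proof.
move=> la lb.
have key t : 0 <= ip a a - 2 * t * ip a b + t ^+ 2 * ip b b.
  have := ip_ge0 (fun n => a n - t * b n); have lt := rl2Z t lb.
  by rewrite (ipBB la lt) (ipZr _ la lb) (ipZl _ lb lt) (ipZr _ lb lb) expr2 !mulrA.
move: key (ip_ge0 a) (ip_ge0 b).
move: (ip a a) (ip a b) (ip b b) => x y z key x0 z0.
have [z_eq0|z_neq0] := eqVneq z 0.
  have [->|y0] := eqVneq y 0; first by rewrite expr0n/= mulr_ge0.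
  (* With [z = 0] the quadratic in [t] is affine; at this [t] it equals [- 2 - x < 0], which is
     absurd. *)
  by have := key ((1 + x) / y); rewrite z_eq0 mulr0 addr0 -mulrA divfK//; lra.
have {}z0 : 0 < z by rewrite lt_def z_neq0.
have : 0 <= z * (x - 2 * (y / z) * y + (y / z) ^+ 2 * z) by rewrite mulr_ge0// ltW.
have -> : z * (x - 2 * (y / z) * y + (y / z) ^+ 2 * z) = x * z - y ^+ 2 by field.
by rewrite subr_ge0.
Qed.

Definition fsupp s a := fun n => if n \in s then a n else 0.

Lemma rl2_fsupp s a : uniq s -> rl2 (fsupp s a).
Proof.
move=> us; have [+ _] := fsum_seq (fun n => a n * a n * v n) us.
by congr rsummable; apply/funext => n; rewrite /fsupp; case: ifP; rewrite // !mul0r.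
Qed.

Lemma ip_fsupp s a b : uniq s -> ip (fsupp s a) b = \sum_(n <- s) a n * b n * v n.
Proof.
move=> us; have [_ <-] := fsum_seq (fun n => a n * b n * v n) us.
by congr fsum; apply/funext => n; rewrite /fsupp; case: ifP; rewrite // !mul0r.
Qed.

Lemma rl2_bound a M : (forall s, uniq s -> \sum_(n <- s) a n * a n * v n <= M) ->
  rl2 a /\ ip a a <= M.
Proof.
by apply: ge0_rsummable_bound => n; rewrite mulr_ge0// -expr2 sqr_ge0.
Qed.

Lemma fsupp_cons n s a : n \notin s ->
  fsupp (n :: s) a = (fun m => fsupp [:: n] a m + fsupp s a m).
Proof.
move=> ns; apply/funext => m; rewrite /fsupp in_cons mem_seq1.
by have [->|_] := eqVneq m n; rewrite /= ?(negbTE ns) ?addr0 ?add0r.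
Qed.

(** Density of finitely supported sequences, stated without a topology. The factor 2 in the
    subadditivity is what a quadratic quantity satisfies, so the lemma covers both the Parseval
    defect and the square of a bounded linear functional. *)
Lemma eq0_of_dense (D : (I -> R) -> R) C : 0 <= C ->
  (forall a, rl2 a -> 0 <= D a) ->
  (forall a b, rl2 a -> rl2 b -> D (fun n => a n + b n) <= 2 * D a + 2 * D b) ->
  (forall a, rl2 a -> D a <= C * ip a a) ->
  (forall n a, D (fsupp [:: n] a) = 0) ->
  forall a, rl2 a -> D a = 0.
Proof.
move=> C0 D0 Dadd DC Dn a la.
have Ds s : uniq s -> D (fsupp s a) <= 0.
  elim: s => [_|n s ih /= /andP[ns us]].
    apply: le_trans (DC _ (rl2_fsupp a (s := [::]) isT)) _.
    by rewrite ip_fsupp// big_nil mulr0.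
  rewrite fsupp_cons//; apply: le_trans (Dadd _ _ _ _) _; [exact: rl2_fsupp..|].
  by rewrite Dn mulr0 add0r; have := ih us; lra.
apply/eqP; rewrite eq_le D0// andbT; apply/ler_addgt0Pl => e e0; rewrite addr0.
(* The tail contributes at most [2 * C] times its square norm, hence at most [e]; [C + 1] keeps the
   divisor positive when [C = 0]. *)
have [|s us tl] := @fsum_tail _ _ _ (e / (2 * (C + 1))) la.
  by rewrite divr_gt0// mulr_gt0// ltr_wpDl.
pose t n := if n \in s then 0 else a n.
have lt : rl2 t.
  apply: rsummable_dom (rsummable_abs la) => n; rewrite /t.
  by case: ifP; rewrite // !mul0r normr0.
have aE : a = (fun n => fsupp s a n + t n).
  by apply/funext => n; rewrite /fsupp /t; case: ifP; rewrite ?addr0 ?add0r.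
have {}tl : ip t t <= e / (2 * (C + 1)).
  apply: le_trans tl; rewrite le_eqVlt; apply/orP; left; apply/eqP.
  congr fsum; apply/funext => n; rewrite /t; case: ifP; rewrite ?mul0r// ger0_norm//.
  by rewrite mulr_ge0// -expr2 sqr_ge0.
rewrite {1}aE; apply: le_trans (Dadd _ _ _ _) _ => //; first exact: rl2_fsupp.
have := Ds s us; have := DC t lt.
have : 2 * (C * ip t t) <= e.
  apply: (@le_trans _ _ (2 * (C * (e / (2 * (C + 1)))))).
    by rewrite ler_pM2l// ler_wpM2l.
  rewrite (_ : 2 * _ = e * (C / (C + 1))).
    by rewrite ger_pMr// ler_pdivrMr ?mul1r ?ltr_wpDl// lerDl.
  by field; lra.
by lra.
Qed.

End weighted_inner_product.

(** * Bessel's inequality, surjectivity and the Parseval defect *)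

Section orthogonal_family.
Context {R : realType} {I J : choiceType}.
Variables (v : I -> R) (w : J -> R) (e : J -> I -> R).
Hypothesis v_gt0 : forall n, 0 < v n.
Hypothesis w_gt0 : forall j, 0 < w j.
Hypothesis e_l2 : forall j, rl2 v (e j).
Hypothesis e_orth : forall j k, j != k -> ip v (e j) (e k) = 0.
Hypothesis e_norm : forall j, ip v (e j) (e j) = (w j)^-1.
Implicit Types (a g : I -> R) (b : J -> R).

Let v0 n : 0 <= v n. Proof. exact: ltW. Qed.
Let w0 j : 0 <= w j. Proof. exact: ltW. Qed.

(** The [e j] are not normalized: their square norm is [(w j)^-1], so weighting by [w] makes the
    square norm of [coef a] the usual sum of squared Fourier coefficients. *)
Definition coef a := fun j => ip v a (e j).

Lemma coefD a g : rl2 v a -> rl2 v g ->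
  coef (fun n => a n + g n) = (fun j => coef a j + coef g j).
Proof. by move=> la lg; apply/funext => j; rewrite /coef ipDl. Qed.

Lemma coefZ k a : rl2 v a -> coef (fun n => k * a n) = (fun j => k * coef a j).
Proof. by move=> la; apply/funext => j; rewrite /coef ipZl. Qed.

Lemma coef_e j k : coef (e j) k = if k == j then (w j)^-1 else 0.
Proof. by rewrite /coef; have [->//|kj] := eqVneq; rewrite e_orth 1?eq_sym. Qed.

Lemma bessel a : rl2 v a ->
  rl2 w (coef a) /\ ip w (coef a) (coef a) <= ip v a a.
Proof.
move=> la; apply: rl2_bound => // s us.
(* [p] is the residual of [a] after projecting out the [e j] with [j] in [s]. The last clause makes
   the next coefficient to remove that of [a] itself. *)
suff [p [lp pE pc]] : exists p : I -> R, [/\ rl2 v p,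
    ip v p p = ip v a a - \sum_(j <- s) coef a j * coef a j * w j &
    forall j, j \notin s -> coef p j = coef a j].
  by have := ip_ge0 v0 p; rewrite pE subr_ge0.
elim: s us => [_|j s ih /= /andP[js /ih[p [lp pE pc]]]].
  by exists a; split=> //; rewrite big_nil subr0.
have le := rl2Z (w j * coef a j) (e_l2 j).
exists (fun n => p n - w j * coef a j * e j n); split.
- exact: rl2B.
- rewrite (ipBB v0 lp le) (ipZr v0 _ lp (e_l2 j)) (ipZl v0 _ (e_l2 j) le).
  rewrite (ipZr v0 _ (e_l2 j) (e_l2 j)) e_norm pE big_cons -/(coef p j) pc//.
  by field; rewrite gt_eqF.
- move=> k; rewrite in_cons negb_or => /andP[kj ks]; rewrite -(pc k ks).
  rewrite /coef (ipBl v0 lp le (e_l2 k)) (ipZl v0 _ (e_l2 j) (e_l2 k)).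
  by rewrite e_orth 1?eq_sym// mulr0 subr0.
Qed.

Lemma coef_fsupp1 n a j : coef (fsupp [:: n] a) j = a n * e j n * v n.
Proof. by rewrite /coef ip_fsupp// big_seq1. Qed.

(** Bessel for the point mass of height [(v n)^-1] at [n], whose coefficient against [e j] is
    [e j n]. This makes the adjoint in the next lemma well defined. *)
Lemma e_dual_l2 n : rl2 w (e ^~ n).
Proof.
have [+ _] := bessel (rl2_fsupp v (fun=> (v n)^-1) (s := [:: n]) isT).
congr rl2; apply/funext => j; rewrite coef_fsupp1 mulrAC mulVf ?mul1r//.
by rewrite gt_eqF.
Qed.

(* The preimage is the adjoint image [a n = sum_j b_j w_j e_j(n)]: pairing it with
   finitely supported sequences gives [ip v a g = ip w b (coef g)], which extends
   to all [g] by density, and in particular to [g = e k]. *)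
Lemma coef_surjective b : rl2 w b -> exists2 a, rl2 v a & coef a = b.
Proof.
move=> lb; pose a n := ip w b (e ^~ n).
have dual c s : uniq s -> ip w b (coef (fsupp s c)) = \sum_(n <- s) c n * a n * v n.
  elim: s => [_|n s ih /= /andP[ns us]].
    rewrite big_nil -[RHS](fsum0 (I := J)); congr fsum; apply/funext => j.
    by rewrite /coef ip_fsupp// big_nil mulr0 mul0r.
  have [l1 l2] := (rl2_fsupp v c (s := [:: n]) isT, rl2_fsupp v c us).
  rewrite fsupp_cons// coefD// big_cons -ih// ipDr; last first.
  - exact: lb.
  - by have [] := bessel l2.
  - by have [] := bessel l1.
  - exact: w0.
  congr (_ + _); rewrite (_ : coef _ = (fun j => c n * v n * e j n)); last first.
    by apply/funext => j; rewrite coef_fsupp1 mulrAC.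
  by rewrite ipZr//; [rewrite mulrAC|exact: e_dual_l2].
(* A self-improving bound: a partial sum S of the square norm of [a] equals the pairing of [b] with
   the coefficients of the truncation of [a]. Young and Bessel give 2 S <= |b|^2 + S. *)
have [la Qa] : rl2 v a /\ ip v a a <= ip w b b.
  apply: rl2_bound => // s us; have lg := rl2_fsupp v a us.
  have [lc Qc] := bessel lg.
  have := ip_young w0 lb lc; rewrite dual//.
  have : ip v (fsupp s a) (fsupp s a) = \sum_(n <- s) a n * a n * v n.
    rewrite ip_fsupp//; apply: eq_big_seq => n ns.
    by rewrite /fsupp ns.
  by move: Qc => /[swap] ->; lra.
exists a => //; apply/funext => k.
pose D g := (ip v a g - ip w b (coef g)) ^+ 2.
suff : D (e k) = 0.
  move=> /eqP; rewrite sqrf_eq0 subr_eq0 -/(coef a k) => /eqP ->.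
  have [_] := fsum_seq (fun j => b j) (s := [:: k]) isT.
  rewrite big_seq1 => <-; congr fsum; apply/funext => j.
  rewrite coef_e mem_seq1; case: eqVneq => [->|_]; last by rewrite mulr0 mul0r.
  by rewrite divfK// gt_eqF.
(* The constant comes from (x - y)^2 <= 2 x^2 + 2 y^2 and Cauchy-Schwarz for each pairing. *)
apply: (@eq0_of_dense _ _ v v0 D (2 * (ip v a a + ip w b b))) => //.
- by rewrite mulr_ge0// addr_ge0// ip_ge0.
- by move=> g _; rewrite sqr_ge0.
- move=> g h lg lh; have [cg _] := bessel lg; have [ch _] := bessel lh.
  rewrite /D coefD// ipDr// ipDr//.
  move: (ip v a g) (ip v a h) (ip w b _) (ip w b _) => x1 x2 x3 x4.
  by have := sqr_ge0 (x1 - x4 - (x2 - x3)); nra.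
- move=> g lg; have [cg Qg] := bessel lg.
  have h1 := cauchy_schwarz v0 la lg; have h2 := cauchy_schwarz w0 lb cg.
  have h3 : ip w b b * ip w (coef g) (coef g) <= ip w b b * ip v g g.
    by rewrite ler_wpM2l// ip_ge0.
  rewrite /D; move: h1 h2 h3.
  move: (ip v a g) (ip w b (coef g)) (ip w b b * ip w _ _) => x y z h1 h2 h3.
  have := sqr_ge0 (x + y); rewrite -mulrA [(_ + _) * ip v g g]mulrDl; move: h1 h2 h3.
  move: (ip v a a * _) (ip w b b * _) => p q; nra.
- move=> n c; rewrite /D dual// ipC ip_fsupp//.
  by rewrite !big_seq1 subrr expr0n.
Qed.

Definition defect a := ip v a a - ip w (coef a) (coef a).

Lemma defect_ge0 a : rl2 v a -> 0 <= defect a.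
Proof. by move=> /bessel[_]; rewrite /defect subr_ge0. Qed.

Lemma defect_le a : defect a <= ip v a a.
Proof. by rewrite lerBlDr lerDl ip_ge0. Qed.

Lemma defectZ k a : rl2 v a -> defect (fun n => k * a n) = k ^+ 2 * defect a.
Proof.
move=> la; have lk := rl2Z k la; have [ca _] := bessel la.
rewrite /defect (ipZl v0 k la lk) (ipZr v0 k la la) coefZ//.
by rewrite (ipZl w0 k ca (rl2Z k ca)) (ipZr w0 k ca ca); ring.
Qed.

(** The defect is a nonnegative quadratic form, so this is the parallelogram law with the term for
    [a - g] dropped. *)
Lemma defectD a g : rl2 v a -> rl2 v g ->
  defect (fun n => a n + g n) <= 2 * defect a + 2 * defect g.
Proof.
move=> la lg; have [[ca _] [cg _]] := (bessel la, bessel lg).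
have := defect_ge0 (rl2B v0 la lg); rewrite /defect (coefD la lg).
have -> : coef (fun n => a n - g n) = (fun j => coef a j - coef g j).
  by apply/funext => j; rewrite /coef ipBl.
rewrite (ipBB v0 la lg) (ipBB w0 ca cg) (ipDD v0 la lg) (ipDD w0 ca cg).
move: (ip v a a) (ip v a g) (ip v g g) => x1 x2 x3.
by move: (ip w _ _) (ip w _ _) (ip w _ _) => y1 y2 y3; lra.
Qed.

(** Defect zero passes to limits because [defect] is at most the square norm. It thus suffices to
    approximate each point mass by vectors of defect zero. *)
Lemma coef_isometry :
  (forall n eps, 0 < eps -> exists g, [/\ rl2 v g, defect g = 0 &
     ip v (fun m => (m == n)%:R - g m) (fun m => (m == n)%:R - g m) <= eps]) ->
  forall a, rl2 v a -> ip w (coef a) (coef a) = ip v a a.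
Proof.
move=> approx a la; apply/eqP; rewrite eq_sym -subr_eq0 -/(defect a); apply/eqP.
move: a la; apply: (@eq0_of_dense _ _ v v0 defect 1) => //.
- exact: defect_ge0.
- exact: defectD.
- by move=> a _; rewrite mul1r defect_le.
move=> n a; pose d m : R := (m == n)%:R.
have dE : fsupp [:: n] a = (fun m => a n * d m).
  apply/funext => m; rewrite /fsupp /d mem_seq1.
  by case: eqVneq => [->|_]; rewrite ?mulr1 ?mulr0.
have ld : rl2 v d.
  have := rl2_fsupp v (fun=> 1) (s := [:: n]) isT; congr rl2.
  by apply/funext => m; rewrite /fsupp /d mem_seq1; case: eqP.
rewrite dE defectZ//; suff -> : defect d = 0 by rewrite mulr0.
apply/eqP; rewrite eq_le defect_ge0// andbT; apply/ler_addgt0Pl => eps eps0.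
rewrite addr0; have [//|g [lg g0 ge]] := approx n (eps / 2); first by rewrite divr_gt0.
have lr := rl2B v0 ld lg.
have := defectD lg lr; rewrite (_ : (fun m => _ + _) = d); last first.
  by apply/funext => m; rewrite addrC subrK.
have := defect_le (fun m => d m - g m); rewrite g0; move: ge.
by move: (ip v _ _) (defect _) (defect d) => x y z; lra.
Qed.

Lemma coef_polarized : (forall a, rl2 v a -> ip w (coef a) (coef a) = ip v a a) ->
  forall a g, rl2 v a -> rl2 v g -> ip w (coef a) (coef g) = ip v a g.
Proof.
move=> iso a g la lg; have [[ca _] [cg _]] := (bessel la, bessel lg).
have := iso _ (rl2D v0 la lg); rewrite coefD// (ipDD v0 la lg) (ipDD w0 ca cg).
by rewrite !iso//; lra.
Qed.

End orthogonal_family.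

(** * Complex families *)

Section complex_parts.
Context {R : realType}.
Local Notation Re := complex.Re.
Local Notation Im := complex.Im.
Local Notation normc := Normc.normc.
Implicit Types (x y z : R[i]) (k : R).

Lemma ReD x y : Re (x + y) = Re x + Re y. Proof. by case: x; case: y. Qed.
Lemma ImD x y : Im (x + y) = Im x + Im y. Proof. by case: x; case: y. Qed.
Lemma ReN x : Re (- x) = - Re x. Proof. by case: x. Qed.
Lemma ImN x : Im (- x) = - Im x. Proof. by case: x. Qed.
Lemma ReM x y : Re (x * y) = Re x * Re y - Im x * Im y.
Proof. by case: x; case: y. Qed.
Lemma ImM x y : Im (x * y) = Re x * Im y + Im x * Re y.
Proof. by case: x; case: y. Qed.

Definition ReImE := (ReD, ImD, ReN, ImN, ReM, ImM).

Lemma sqr_normc z : normc z ^+ 2 = Re z ^+ 2 + Im z ^+ 2.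
Proof. by case: z => a b /=; rewrite sqr_sqrtr// addr_ge0// sqr_ge0. Qed.

Lemma normc_ge0 z : 0 <= normc z.
Proof. by case: z => a b /=; exact: sqrtr_ge0. Qed.

Lemma normc_gt0 z : z != 0 -> 0 < normc z.
Proof.
by move=> z0; rewrite lt_def normc_ge0 andbT; apply: contra z0 => /eqP/Normc.eq0_normc ->.
Qed.

Lemma normcR k : normc k%:C = `|k|.
Proof. by rewrite /= expr0n addr0 sqrtr_sqr. Qed.

Lemma Re_le_normc z : `|Re z| <= normc z.
Proof.
rewrite -(@ler_pXn2r _ 2) ?nnegrE ?normc_ge0//.
by rewrite sqr_normc real_normK ?num_real// lerDl sqr_ge0.
Qed.

Lemma Im_le_normc z : `|Im z| <= normc z.
Proof.
rewrite -(@ler_pXn2r _ 2) ?nnegrE ?normc_ge0//.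
by rewrite sqr_normc real_normK ?num_real// lerDr sqr_ge0.
Qed.

Lemma normc_le z : normc z <= `|Re z| + `|Im z|.
Proof.
rewrite -(@ler_pXn2r _ 2) ?nnegrE ?normc_ge0 ?addr_ge0//.
rewrite sqr_normc -(real_normK (num_real (Re z))) -(real_normK (num_real (Im z))).
by have := normr_ge0 (Re z); have := normr_ge0 (Im z); nra.
Qed.

Lemma normcE z : `|z| = (normc z)%:C.
Proof. by case: z. Qed.

Lemma ImV z : Im z^-1 = - Im z * normc z ^- 2.
Proof. by rewrite sqr_normc; case: z => a b /=; rewrite mulNr. Qed.

Lemma ReV z : Re z^-1 = Re z * normc z ^- 2.
Proof. by rewrite sqr_normc; case: z. Qed.

Lemma Re_conj z : Re z^* = Re z. Proof. by case: z. Qed.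
Lemma Im_conj z : Im z^* = - Im z. Proof. by case: z. Qed.

Lemma complex_ext x y : Re x = Re y -> Im x = Im y -> x = y.
Proof. by case: x; case: y => a b c d /= -> ->. Qed.

End complex_parts.

Section complex_families.
Context {R : realType} {I : choiceType}.
Local Notation Re := complex.Re.
Local Notation Im := complex.Im.
Local Notation normc := Normc.normc.
Implicit Types (f g : I -> R[i]).

Definition csummable f := rsummable (fun n => normc (f n)).

Lemma csummable_Re f : csummable f -> rsummable (fun n => Re (f n)).
Proof. by apply: rsummable_dom => n; exact: Re_le_normc. Qed.

Lemma csummable_Im f : csummable f -> rsummable (fun n => Im (f n)).
Proof. by apply: rsummable_dom => n; exact: Im_le_normc. Qed.

Lemma csummable_dom f (h : I -> R) : (forall n, normc (f n) <= h n) ->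
  rsummable h -> csummable f.
Proof.
by move=> fh; apply: rsummable_dom => n; rewrite ger0_norm ?normc_ge0.
Qed.

Lemma csummableZ (k : R[i]) f : csummable f -> csummable (fun n => k * f n).
Proof.
move=> /(rsummableZ (normc k)); apply: csummable_dom => n.
by rewrite Normc.normcM.
Qed.

Lemma csummableD f g : csummable f -> csummable g ->
  csummable (fun n => f n + g n).
Proof.
by move=> fs gs; apply: csummable_dom (rsummableD fs gs) => n; exact: le_normcD.
Qed.

Lemma csumD f g : csummable f -> csummable g ->
  csum (fun n => f n + g n) = csum f + csum g.
Proof.
move=> fs gs; apply: complex_ext; rewrite /csum/=.
  rewrite -fsumD; [|exact: csummable_Re..].
  by congr fsum; apply/funext => n; rewrite ReD.
rewrite -fsumD; [|exact: csummable_Im..].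
by congr fsum; apply/funext => n; rewrite ImD.
Qed.

Lemma csumZ (k : R[i]) f : csummable f -> csum (fun n => k * f n) = k * csum f.
Proof.
move=> fs; have [rs is_] := (csummable_Re fs, csummable_Im fs).
apply: complex_ext; rewrite /csum ReImE/= -!fsumZ//.
  rewrite -fsumB; [|exact: rsummableZ..].
  by congr fsum; apply/funext => n; rewrite ReM.
rewrite -fsumD; [|exact: rsummableZ..].
by congr fsum; apply/funext => n; rewrite ImM.
Qed.

Lemma csumB f g : csummable f -> csummable g ->
  csum (fun n => f n - g n) = csum f - csum g.
Proof.
move=> fs gs; rewrite -[in RHS]mulN1r -csumZ// -csumD//; last exact: csummableZ.
by congr csum; apply/funext => n; rewrite mulN1r.
Qed.

Lemma csum_conj f : csummable f -> csum (fun n => (f n)^*) = (csum f)^*.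
Proof.
move=> fs; apply: complex_ext => /=.
  by congr fsum; apply/funext => n; rewrite Re_conj.
rewrite -fsumN; last exact: csummable_Im.
by congr fsum; apply/funext => n; rewrite Im_conj.
Qed.

(** The factor 2 is the price of bounding real and imaginary parts separately; it reappears in the
    constants of later estimates. *)
Lemma normc_csum f : csummable f ->
  normc (csum f) <= 2 * fsum (fun n => normc (f n)).
Proof.
move=> fs; have [rs is_] := (csummable_Re fs, csummable_Im fs).
apply: le_trans (normc_le _) _; rewrite mulr2n mulrDl !mul1r lerD//=.
- apply: le_trans (ler_norm_fsum rs) _; apply: le_fsum => //.
  + exact: rsummable_abs.
  + by move=> n; exact: Re_le_normc.
- apply: le_trans (ler_norm_fsum is_) _; apply: le_fsum => //.
  + exact: rsummable_abs.
  + by move=> n; exact: Im_le_normc.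
Qed.

Lemma csum_real (h : I -> R) : csum (fun n => (h n)%:C) = (fsum h)%:C.
Proof. by apply: complex_ext => //=; exact: fsum0. Qed.

End complex_families.

Section complex_l2.
Context {R : realType} {I : choiceType}.
Local Notation Re := complex.Re.
Local Notation Im := complex.Im.
Local Notation normc := Normc.normc.
Variable v : I -> R.
Hypothesis v0 : forall n, 0 <= v n.
Implicit Types a : I -> R[i].

Lemma l2P a : l2 v a <-> rsummable (fun n => normc (a n) ^+ 2 * v n).
Proof.
by rewrite /l2/= ge0_rsummable// => n; rewrite mulr_ge0// exprn_ge0// normc_ge0.
Qed.

Lemma l2_parts a : l2 v a <-> rl2 v (fun n => Re (a n)) /\ rl2 v (fun n => Im (a n)).
Proof.
rewrite l2P; split=> [la|[lr li]].
  split; apply: rsummable_dom la => n.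
  + rewrite ger0_norm; last by rewrite mulr_ge0// -expr2 sqr_ge0.
    by rewrite ler_wpM2r// sqr_normc -expr2 lerDl sqr_ge0.
  + rewrite ger0_norm; last by rewrite mulr_ge0// -expr2 sqr_ge0.
    by rewrite ler_wpM2r// sqr_normc -expr2 lerDr sqr_ge0.
have := rsummableD lr li; congr rsummable; apply/funext => n.
by rewrite sqr_normc; ring.
Qed.

Lemma fsum_sqr_normc a : l2 v a -> fsum (fun n => normc (a n) ^+ 2 * v n) =
  ip v (fun n => Re (a n)) (fun n => Re (a n)) +
  ip v (fun n => Im (a n)) (fun n => Im (a n)).
Proof.
move=> /l2_parts[lr li]; rewrite /ip -fsumD//; congr fsum; apply/funext => n.
by rewrite sqr_normc; ring.
Qed.

Lemma l2norm_parts a : l2 v a -> l2norm v a =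
  Num.sqrt (ip v (fun n => Re (a n)) (fun n => Re (a n)) +
            ip v (fun n => Im (a n)) (fun n => Im (a n))).
Proof.
move=> la; rewrite /l2norm -(fsum_sqr_normc la) -fsum_ge0E /=; first by [].
  by move=> n; rewrite mulr_ge0// sqr_ge0.
exact: (l2P a).1.
Qed.

(** Bilinear, without conjugation: this is the pairing of kernels that the resolvent identity
    produces. *)
Definition cip a b := csum (fun n => a n * b n * (v n)%:C).

Lemma cip_parts a b : l2 v a -> l2 v b ->
  let ar n := Re (a n) in let ai n := Im (a n) in
  let br n := Re (b n) in let bi n := Im (b n) in
  cip a b = (ip v ar br - ip v ai bi) +i* (ip v ar bi + ip v ai br).
Proof.
move=> /l2_parts[lar lai] /l2_parts[lbr lbi] /=.
apply: complex_ext => /=.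
- rewrite /ip -fsumB; [|exact: ip_summable..].
  by congr fsum; apply/funext => n; rewrite !ReImE/=; ring.
- rewrite /ip -fsumD; [|exact: ip_summable..].
  by congr fsum; apply/funext => n; rewrite !ReImE/=; ring.
Qed.

Lemma csummable_cip a b : l2 v a -> l2 v b ->
  csummable (fun n => a n * b n * (v n)%:C).
Proof.
move=> /l2P la /l2P lb; apply: csummable_dom (rsummableD la lb) => n.
rewrite !Normc.normcM normcR (ger0_norm (v0 n)) -mulrDl ler_wpM2r//.
have := normc_ge0 (a n); have := normc_ge0 (b n).
have := sqr_ge0 (normc (a n) - normc (b n)).
by nra.
Qed.

End complex_l2.

Section complex_unitary.
Context {R : realType} {I J : choiceType}.
Local Notation Re := complex.Re.
Local Notation Im := complex.Im.
Variables (v : I -> R) (w : J -> R) (e : J -> I -> R).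
Hypothesis v_gt0 : forall n, 0 < v n.
Hypothesis w_gt0 : forall j, 0 < w j.
Hypothesis e_l2 : forall j, rl2 v (e j).
Hypothesis e_orth : forall j k, j != k -> ip v (e j) (e k) = 0.
Hypothesis e_norm : forall j, ip v (e j) (e j) = (w j)^-1.
Variable T : (I -> R[i]) -> J -> R[i].
Hypothesis TE : forall a, T a = fun j =>
  coef v e (fun n => Re (a n)) j +i* coef v e (fun n => Im (a n)) j.

Let v0 n : 0 <= v n. Proof. exact: ltW. Qed.
Let w0 j : 0 <= w j. Proof. exact: ltW. Qed.

Lemma T_l2 a : l2 v a -> l2 w (T a).
Proof.
move=> /(l2_parts v0)[lr li]; apply/(l2_parts w0); rewrite TE/=.
have [cr _] := bessel v_gt0 w_gt0 e_l2 e_orth e_norm lr.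
by have [ci _] := bessel v_gt0 w_gt0 e_l2 e_orth e_norm li.
Qed.

(** Every clause except the isometry holds for any orthogonal family with these norms. As the [e j]
    are real, testing the isometry on real sequences already gives the complex case. *)
Lemma unitaryP : unitary v w T <->
  forall a, rl2 v a -> ip w (coef v e a) (coef v e a) = ip v a a.
Proof.
split=> [[_ _ iso _] a la|iso].
  have l0 : rl2 v (fun=> 0).
    by apply: rsummable_dom la => n; rewrite !mul0r normr0 mulr_ge0// -expr2 sqr_ge0.
  have lac : l2 v (fun n => (a n)%:C) by apply/(l2_parts v0).
  have z0 (K : choiceType) (u : K -> R) c : ip u (fun=> 0) c = 0.
    by rewrite -[RHS](fsum0 (I := K)); congr fsum; apply/funext => n; rewrite !mul0r.
  have c0 : coef v e (fun=> 0) = (fun=> 0) by apply/funext => j; exact: z0.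
  have := iso _ lac; rewrite (l2norm_parts w0 (T_l2 lac)) (l2norm_parts v0 lac) TE/=.
  rewrite c0 !z0 !addr0 => /(congr1 (fun x => x ^+ 2)).
  by rewrite !sqr_sqrtr ?ip_ge0.
split.
- exact: T_l2.
- move=> k a b /(l2_parts v0)[ar ai] /(l2_parts v0)[br bi].
  have lZ c := (rl2Z c ar, rl2Z c ai).
  rewrite !TE; apply/funext => j; apply: complex_ext; rewrite !ReImE/= /coef.
  + rewrite -!ipZl// -ipBl// -?ipDl//;
      [|exact: (rl2B v0 (rl2Z _ ar) (rl2Z _ ai))|exact: (lZ _).1|exact: (lZ _).2].
    by congr (ip v _ (e j)); apply/funext => n; rewrite !ReImE.
  + rewrite -!ipZl// -!ipDl//;
      [|exact: (rl2D v0 (rl2Z _ ai) (rl2Z _ ar))|exact: (lZ _).2|exact: (lZ _).1].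
    by congr (ip v _ (e j)); apply/funext => n; rewrite !ReImE.
- move=> a la; rewrite (l2norm_parts w0 (T_l2 la)) (l2norm_parts v0 la) TE/=.
  by have [lr li] := (l2_parts v0 a).1 la; rewrite !iso.
- move=> b /(l2_parts w0)[br bi].
  have [ar lar arE] := coef_surjective v_gt0 w_gt0 e_l2 e_orth e_norm br.
  have [ai lai aiE] := coef_surjective v_gt0 w_gt0 e_l2 e_orth e_norm bi.
  exists (fun n => ar n +i* ai n); first exact/(l2_parts v0).
  rewrite TE; apply/funext => j; apply: complex_ext => /=.
  + by rewrite (_ : (fun n => ar n) = ar)// arE.
  + by rewrite (_ : (fun n => ai n) = ai)// aiE.
Qed.

End complex_unitary.

(** * The function phi and its resolvent identity *)

Section phi_theory.
Context {R : realType} {I : countType}.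
Local Notation Re := complex.Re.
Local Notation Im := complex.Im.
Local Notation normc := Normc.normc.
Variables (gamma : I -> R[i]) (v : I -> R) (alpha : R).
Hypothesis I_nonempty : [set: I] !=set0.
Hypothesis adm : admissible gamma v.
Hypothesis gamma_real : forall n, Im (gamma n) = 0.
Implicit Types (z u : R[i]).

Let v_gt0 n : 0 < v n. Proof. by case: adm. Qed.
Let v0 n : 0 <= v n. Proof. exact: ltW. Qed.

Local Notation star := (star gamma v).
Local Notation phi := (phi gamma v).

Let ci : R[i] := 0 +i* 1.

Definition kernel z n := (gamma n - z)^-1.

Lemma l2_kernel z : star z -> l2 v (kernel z).
Proof.
move=> [zg]; apply: le_lt_trans; apply: le_esum => n _; rewrite lee_fin.
by rewrite /kernel Normc.normcV exprVn -normcN opprB mulrC.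
Qed.

Lemma star_neq z n : star z -> gamma n - z != 0.
Proof. by move=> [/(_ n)]; rewrite subr_eq0 eq_sym. Qed.

Lemma nonreal_neq z n : Im z != 0 -> z != gamma n.
Proof. by apply: contraNneq => ->; rewrite gamma_real. Qed.

Lemma nonreal_star z : Im z != 0 -> star z.
Proof.
move=> z0; split=> [n|]; first exact: nonreal_neq.
have [_ _ sv] := adm.
set x := Re z; set y := Im z in z0.
have y2 : 0 < y ^+ 2 by rewrite exprn_even_gt0.
(* Chosen so that 1 + g^2 <= C ((x - g)^2 + y^2) for all real g: use g^2 <= 2 (x - g)^2 + 2 x^2, and
   absorb the remaining 1 + 2 x^2 by means of y^2. *)
pose C := 2 + (1 + 2 * x ^+ 2) / y ^+ 2.
have x1 : 0 <= 1 + 2 * x ^+ 2 by rewrite addr_ge0// mulr_ge0// sqr_ge0.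
have sv' : rsummable (fun n => v n / (1 + normc (gamma n) ^+ 2)).
  by rewrite ge0_rsummable// => n; rewrite divr_ge0// addr_ge0// sqr_ge0.
suff : rsummable (fun n => v n / normc (z - gamma n) ^+ 2).
  by rewrite ge0_rsummable// => n; rewrite divr_ge0// sqr_ge0.
apply: rsummable_dom (rsummableZ C sv') => n.
have d0 : 0 < normc (z - gamma n) ^+ 2.
  by rewrite exprn_gt0// normc_gt0// subr_eq0 nonreal_neq.
have e0 : 0 < 1 + normc (gamma n) ^+ 2 by rewrite ltr_wpDr// sqr_ge0.
rewrite ger0_norm; last by rewrite divr_ge0// ltW.
rewrite mulrCA ler_pM2l// ler_pdivlMr// mulrC ler_pdivrMr//.
rewrite !sqr_normc !ReImE gamma_real oppr0 addr0 expr0n addr0 -/x -/y.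
set g := Re _.
have -> : C * ((x - g) ^+ 2 + y ^+ 2) =
  2 * ((x - g) ^+ 2 + y ^+ 2) + 1 + 2 * x ^+ 2 +
  (1 + 2 * x ^+ 2) * ((x - g) ^+ 2 / y ^+ 2) by rewrite /C; field.
have : 0 <= (1 + 2 * x ^+ 2) * ((x - g) ^+ 2 / y ^+ 2).
  by rewrite mulr_ge0 ?divr_ge0 ?sqr_ge0.
move: ((1 + 2 * x ^+ 2) * _) => t t0.
by have := sqr_ge0 (g - 2 * x); have := ltW y2; nra.
Qed.

Let star_i : star ci. Proof. by apply: nonreal_star => /=; rewrite oner_eq0. Qed.
Let star_Ni : star (- ci).
Proof. by apply: nonreal_star => /=; rewrite oppr_eq0 oner_eq0. Qed.

Definition phi_term z n := (v n)%:C * ((gamma n - z)^-1 - gamma n / (1 + gamma n ^+ 2)).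

Lemma resolvent z u n : star z -> star u ->
  kernel z n - kernel u n = (z - u) * (kernel z n * kernel u n).
Proof.
by move=> sz su; rewrite /kernel; field; rewrite !star_neq.
Qed.

Lemma csummable_kernels z u : star z -> star u ->
  csummable (fun n => kernel z n * kernel u n * (v n)%:C).
Proof. by move=> sz su; apply: csummable_cip => //; exact: l2_kernel. Qed.

(* [gamma / (1 + gamma^2)] is the mean of the kernels at [i] and [-i], so each term
   is a combination of two kernel differences. *)
Lemma csummable_phi z : star z -> csummable (phi_term z).
Proof.
move=> sz.
have s1 := csummableZ ((z - ci) / 2) (csummable_kernels sz star_i).
have s2 := csummableZ ((z + ci) / 2) (csummable_kernels sz star_Ni).
have := csummableD s1 s2; congr csummable; apply/funext => n.
have -> : phi_term z n =
    (v n)%:C * ((kernel z n - kernel ci n) / 2 + (kernel z n - kernel (- ci) n) / 2).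
  rewrite /phi_term -/(kernel z n); congr (_ * _).
  have ne1 := star_neq n star_i; have ne2 := star_neq n star_Ni.
  have -> : 1 + gamma n ^+ 2 = (gamma n - ci) * (gamma n - - ci).
    by rewrite opprK -subr_sqr [ci ^+ 2]sqr_i opprK addrC.
  rewrite /kernel -!mulrDl; move: ne1 ne2; move: (gamma n) => g.
  move: ((g - z)^-1) => k; move: ci => c; rewrite opprK => ne1 ne2.
  by field; rewrite ne1 ne2.
by rewrite (resolvent _ sz star_i) (resolvent _ sz star_Ni) opprK; ring.
Qed.

Lemma phi_diff z u : star z -> star u ->
  phi z - phi u = (z - u) * cip v (kernel z) (kernel u).
Proof.
move=> sz su; rewrite -csumB; [|exact: csummable_phi..].
rewrite -csumZ; last exact: csummable_kernels.
congr csum; apply/funext => n.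
by rewrite -mulrBr opprB addrA subrK -/(kernel z n) -/(kernel u n) resolvent//; ring.
Qed.

Lemma summable_kernel z : star z -> rsummable (fun n => normc (kernel z n) ^+ 2 * v n).
Proof. by move=> sz; exact: (l2P v0 _).1 (l2_kernel sz). Qed.

Lemma gamma_ratio n :
  gamma n / (1 + gamma n ^+ 2) = (Re (gamma n) / (1 + Re (gamma n) ^+ 2))%:C.
Proof.
have gE : gamma n = (Re (gamma n))%:C by apply: complex_ext => //=; exact: gamma_real.
rewrite gE /=; move: (Re (gamma n)) => g.
rewrite (_ : 1 + _ = (1 + g ^+ 2)%:C); last by rewrite rmorphD rmorphXn.
by rewrite -fmorphV -rmorphM.
Qed.

Lemma kernel_conj z n : kernel z^* n = (kernel z n)^*.
Proof.
rewrite /kernel conjc_inv; congr (_^-1).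
apply: complex_ext; rewrite ?Re_conj ?Im_conj !ReImE ?Re_conj ?Im_conj ?gamma_real//.
by ring.
Qed.

(** Nonemptiness of the index set enters here. For an empty family [phi] is identically 0 and
    Lambda(0) is the whole plane. Strict positivity is what makes Lambda(alpha) real, its weights
    positive and [alpha - phi] nonzero off the real axis. *)
Lemma cip_kernel_gt0 z : star z -> 0 < fsum (fun n => normc (kernel z n) ^+ 2 * v n).
Proof.
move=> sz; have [n _] := I_nonempty.
have t0 m : 0 <= normc (kernel z m) ^+ 2 * v m by rewrite mulr_ge0// sqr_ge0.
apply: (@lt_le_trans _ _ (normc (kernel z n) ^+ 2 * v n)).
  by rewrite mulr_gt0// exprn_gt0// normc_gt0// invr_eq0 star_neq.
exact: (le_fsum_term n t0 (summable_kernel sz)).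
Qed.

Lemma Im_phi z : star z ->
  Im (phi z) = Im z * fsum (fun n => normc (kernel z n) ^+ 2 * v n).
Proof.
move=> sz; rewrite -fsumZ; last exact: summable_kernel.
rewrite /phi /csum/=; congr fsum; apply/funext => n.
rewrite gamma_ratio /kernel Normc.normcV exprVn !ReImE ImV !ReImE gamma_real/=; ring.
Qed.

Lemma phi_conj z : star z -> phi z^* = (phi z)^*.
Proof.
move=> sz; rewrite -csum_conj; last exact: csummable_phi.
congr csum; apply/funext => n.
rewrite -/(kernel z n) -/(kernel z^* n) kernel_conj gamma_ratio.
by apply: complex_ext; rewrite ?Re_conj ?Im_conj !ReImE ?Re_conj ?Im_conj/=; ring.
Qed.

Local Notation Lam := (Lambda gamma v alpha).

Lemma Lambda_real z : Lam z -> Im z = 0.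
Proof.
move=> [sz /(congr1 (@complex.Im R))/eqP]; rewrite Im_phi//= mulf_eq0 => /orP[/eqP//|].
by rewrite gt_eqF// cip_kernel_gt0.
Qed.

(** This is minus the kernel at [l], written with real entries so that the theory of real orthogonal
    families applies. *)
Definition lamvec (l : Lam) n : R := (Re (\val l) - Re (gamma n))^-1.

Lemma lam_kernel (l : Lam) n : kernel (\val l) n = (- lamvec l n)%:C.
Proof.
have lL : Lam (\val l) := set_valP l.
rewrite /kernel /lamvec -invrN opprB fmorphV; congr (_^-1).
by apply: complex_ext; rewrite !ReImE//= gamma_real (Lambda_real lL) oppr0 addr0.
Qed.

Lemma lam_star (l : Lam) : star (\val l). Proof. by case: (set_valP l). Qed.
Lemma lam_phi (l : Lam) : phi (\val l) = alpha%:C. Proof. by case: (set_valP l). Qed.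

Lemma lamvec_l2 (l : Lam) : rl2 v (lamvec l).
Proof.
have /(l2_parts v0)[+ _] := l2_kernel (lam_star l); congr rsummable.
by apply/funext => n; rewrite lam_kernel/= mulrNN.
Qed.

Lemma cip_lamvec (l l' : Lam) :
  cip v (kernel (\val l)) (kernel (\val l')) = (ip v (lamvec l) (lamvec l'))%:C.
Proof.
rewrite -csum_real; congr csum; apply/funext => n.
by rewrite !lam_kernel -!rmorphM mulrNN.
Qed.

(** [phi] equals [alpha] at both points, so the left side of the resolvent identity vanishes while
    its factor [l - l'] does not. *)
Lemma lamvec_orth (l l' : Lam) : l != l' -> ip v (lamvec l) (lamvec l') = 0.
Proof.
move=> ll'; have := phi_diff (lam_star l) (lam_star l').
rewrite !lam_phi subrr cip_lamvec => /esym/eqP; rewrite mulf_eq0 subr_eq0.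
by rewrite (inj_eq val_inj) (negbTE ll')/= => /eqP[].
Qed.

Lemma lamvec_norm (l : Lam) :
  ip v (lamvec l) (lamvec l) = (weight gamma v (\val l))^-1.
Proof.
rewrite /weight invrK /csum/=; congr fsum; apply/funext => n.
have -> : \val l - gamma n = (- kernel (\val l) n)^-1.
  by rewrite invrN invrK opprB.
rewrite lam_kernel -rmorphN opprK -fmorphV -rmorphXn -fmorphV -rmorphM/=.
by rewrite exprVn invrK mulrC expr2.
Qed.

Lemma weight_gt0 (l : Lam) : 0 < weight gamma v (\val l).
Proof.
rewrite -invr_gt0 -lamvec_norm; have := cip_kernel_gt0 (lam_star l).
congr (0 < fsum _); apply/funext => n; rewrite lam_kernel normcR normrN.
by rewrite real_normK ?num_real// expr2.
Qed.

Lemma dht_parts (a : I -> R[i]) : dht gamma v (L := Lam) a =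
  fun l => coef v lamvec (fun n => Re (a n)) l +i* coef v lamvec (fun n => Im (a n)) l.
Proof.
apply/funext => l; apply: complex_ext => /=; congr fsum; apply/funext => n.
all: rewrite -[(_ - gamma n)^-1]opprK -invrN opprB -/(kernel _ n) lam_kernel -rmorphN opprK.
all: by rewrite !ReImE/=; ring.
Qed.

Lemma dht_kernel z (l : Lam) : star z -> z != \val l ->
  dht gamma v (L := Lam) (kernel z) l = (alpha%:C - phi z) / (z - \val l).
Proof.
move=> sz zl.
have -> : alpha%:C - phi z = - (z - \val l) * cip v (kernel z) (kernel (\val l)).
  by rewrite mulNr -phi_diff ?lam_phi ?opprB//; exact: lam_star.
rewrite mulrAC; have -> : - (z - \val l) / (z - \val l) = -1 by rewrite mulNr divff// subr_eq0.
rewrite /cip -csumZ; last by apply: csummable_kernels => //; exact: lam_star.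
congr csum; apply/funext => n.
by rewrite /kernel -[\val l - gamma n]opprB invrN; ring.
Qed.

End phi_theory.

(** * Atomic measures *)

Section atomic_measure.
Context {R : realType} {J : choiceType}.

(** A summable family exceeds each [n.+1%:R^-1] only finitely often. This supplies the countability
    of Lambda(alpha) needed to put a measure on it. *)
Lemma rsummable_countable (f : J -> R) : (forall j, 0 < f j) -> rsummable f ->
  countable [set: J].
Proof.
move=> f0 fs; have f0' j : 0 <= f j by exact: ltW.
rewrite [X in countable X](_ : _ = \bigcup_n [set j | n.+1%:R^-1 < f j]); last first.
  apply/seteqP; split=> [j _|//]; have /ltr_add_invr[k] := f0 j.
  by rewrite add0r => kj; exists k.
apply: bigcup_countable => // n _; apply: finite_set_countable.
apply: contrapT => inf.
have [N Nlt] : exists N : nat, fsum f * n.+1%:R < N%:R.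
  exists (Num.bound (fsum f * n.+1%:R)); apply: archi_boundP.
  by rewrite mulr_ge0// fsum_ge0.
have [B BA NB] := infinite_set_fset N inf.
have := sum_le_fsum f0' fs (finmap.fset_uniq B); rewrite leNgt => /negP; apply.
rewrite -ltr_pdivlMr// in Nlt; apply: (lt_le_trans Nlt).
apply: (@le_trans _ _ (\sum_(j <- finmap.enum_fset B) (n.+1%:R^-1 : R))).
  rewrite big_const_seq count_predT iter_addr_0 -[leRHS]mulr_natl.
  by rewrite ler_wpM2r// ler_nat.
by rewrite big_seq [leRHS]big_seq; apply: ler_sum => j jB; apply/ltW/BA.
Qed.

Lemma atomic_measureP (x w : J -> R) : (forall j, 0 <= w j) -> countable [set: J] ->
  exists mu : {measure set (measurableTypeR R) -> \bar R},
    forall f : measurableTypeR R -> R, measurable_fun setT f -> (forall t, 0 <= f t) ->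
    (\int[mu]_t (f t)%:E = \esum_(j in [set: J]) (f (x j) * w j)%:E)%E.
Proof.
move=> w0 /countable_injP[g ginj].
have {}ginj : injective g by move=> i j /ginj; apply; rewrite inE.
(* A partial inverse of the injection [g] into nat; indices outside its range will carry the zero
   measure, so a series over nat sums exactly the atoms. *)
pose h n : option J :=
  if pselect (exists j, g j = n) is left e then Some (projT1 (cid e)) else None.
have hg j : h (g j) = Some j.
  rewrite /h; case: pselect => [e|[]]; last by exists j.
  by congr Some; apply: ginj; exact: (projT2 (cid e)).
have hN n : ~ range g n -> h n = None.
  by rewrite /h; case: pselect => // -[j gj] []; exists j.
pose delta j : {measure set (measurableTypeR R) -> \bar R} :=
  @dirac _ (measurableTypeR R) (x j) R.
pose atom j : {measure set (measurableTypeR R) -> \bar R} :=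
  mscale (NngNum (w0 j)) (delta j).
pose m n : {measure set (measurableTypeR R) -> \bar R} :=
  if h n is Some j then atom j else (@mzero _ (measurableTypeR R) R).
exists (mseries m 0) => f mf f0.
have mfE := (measurable_EFinP _ _).2 mf.
rewrite ge0_integral_measure_series//; last by move=> t _; rewrite lee_fin.
pose F n : \bar R := if h n is Some j then (f (x j) * w j)%:E else 0%E.
have F0 n : (0 <= F n)%E by rewrite /F; case: (h n) => // j; rewrite lee_fin mulr_ge0.
rewrite (@eq_eseriesr _ _ F); last first.
  move=> n _; rewrite /m /F; case: (h n) => [j|]; last exact: integral_measure_zero.
  rewrite ge0_integral_mscale//; last by move=> t _; rewrite lee_fin.
  by rewrite integral_dirac// diracT mul1e/= -EFinM mulrC.
rewrite nneseries_esumT//.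
rewrite -[RHS](@eq_esum _ _ _ (F \o g)); last by move=> j _; rewrite /= /F hg.
rewrite -(@esum_image _ _ _ [set: J] g F); last by move=> i j _ _ /ginj.
rewrite [RHS]esum_mkcond; apply: eq_esum => n _.
by case: ifPn => //; rewrite notin_setE => /hN; rewrite /F => ->.
Qed.

Lemma atomic_purely (x w : J -> R) (mu : {measure set (measurableTypeR R) -> \bar R}) :
  countable [set: J] ->
  (forall f : measurableTypeR R -> R, measurable_fun setT f -> (forall t, 0 <= f t) ->
    (\int[mu]_t (f t)%:E = \esum_(j in [set: J]) (f (x j) * w j)%:E)%E) ->
  purely_atomic_measure mu.
Proof.
move=> cJ muE; exists (range x).
  by apply: sub_countable cJ; exact: card_image_le.
have mA : measurable (~` range x : set (measurableTypeR R)).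
  apply: measurableC; apply: countable_measurable => [t|]; first exact: measurable_set1.
  by apply: sub_countable cJ; exact: card_image_le.
rewrite -(setIT (~` range x)) -integral_indic// muE//.
by apply: esum1 => j _; rewrite indicE memNset ?mul0r// => -[]; exists j.
Qed.

Lemma atomic_Rintegral (x w : J -> R) (mu : {measure set (measurableTypeR R) -> \bar R})
    (f : measurableTypeR R -> R) : (forall j, 0 <= w j) ->
  (forall f : measurableTypeR R -> R, measurable_fun setT f -> (forall t, 0 <= f t) ->
    (\int[mu]_t (f t)%:E = \esum_(j in [set: J]) (f (x j) * w j)%:E)%E) ->
  measurable_fun setT f ->
  rsummable (fun j => f (x j) * w j) ->
  \int[mu]_t (f t) = fsum (fun j => f (x j) * w j).
Proof.
move=> w0 muE mf fs.
have [mp mn] := (measurable_funrpos mf, measurable_funrneg mf).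
have pE : (fun j => f (x j) * w j)^\+ = (fun j => f^\+ (x j) * w j).
  by apply/funext => j; rewrite /funrpos maxr_pMl// mul0r.
have nE : (fun j => f (x j) * w j)^\- = (fun j => f^\- (x j) * w j).
  by apply/funext => j; rewrite /funrneg maxr_pMl// mul0r mulNr.
rewrite /Rintegral integralE fsumE// pE nE.
have := rsummable_pos fs; have := rsummable_neg fs; rewrite pE nE => ns ps.
have fp t : ((fun x => (f x)%:E)^\+ t = (f^\+ t)%:E)%E by rewrite funeposE -EFin_max.
have fn t : ((fun x => (f x)%:E)^\- t = (f^\- t)%:E)%E by rewrite funenegE -EFinN -EFin_max.
under eq_integral do rewrite fp.
under [X in (_ - X)%E]eq_integral do rewrite fn.
rewrite (muE _ mp (funrpos_ge0 f)) (muE _ mn (funrneg_ge0 f)).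
by rewrite -!fsum_ge0E// => j; rewrite mulr_ge0.
Qed.

End atomic_measure.

(** * Integrals against a given purely atomic measure *)

Section integrals_of_atomic_measures.
Context {R : realType}.
Variable mu : {measure set (measurableTypeR R) -> \bar R}.
Implicit Types f : measurableTypeR R -> R.

Lemma integral_singleton f (t0 : measurableTypeR R) :
  (\int[mu]_(t in [set t0]) (f t)%:E = (f t0)%:E * mu [set t0])%E.
Proof.
have m1 : measurable [set t0] by exact: measurable_set1.
rewrite -integral_cst//.
by apply: eq_integral => t /set_mem ->.
Qed.

Lemma atom_le_integral f t0 : measurable_fun setT f -> (forall t, 0 <= f t) ->
  ((f t0)%:E * mu [set t0] <= \int[mu]_t (f t)%:E)%E.
Proof.
move=> mf f0; rewrite -integral_singleton; apply: ge0_subset_integral => //.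
  exact/measurable_EFinP.
by move=> t _; rewrite lee_fin.
Qed.

Lemma atomic_integral_le f (A : set R) (M : \bar R) : countable A -> mu (~` A) = 0%E ->
  measurable_fun setT f -> (forall t, 0 <= f t) ->
  (forall s : seq R, uniq s -> (forall t, t \in s -> A t) ->
    \sum_(t <- s) (f t)%:E * mu [set t] <= M)%E ->
  (\int[mu]_t (f t)%:E <= M)%E.
Proof.
move=> cA A0 mf f0 sM.
have m1 (t : measurableTypeR R) : measurable [set t] by exact: measurable_set1.
have mE : measurable_fun setT (fun t => (f t)%:E) := (measurable_EFinP _ _).2 mf.
have mA : measurable (A : set (measurableTypeR R)) by exact: countable_measurable.
have e0 t : (0 <= (f t)%:E)%E by rewrite lee_fin.
rewrite (@ge0_negligible_integral _ _ _ mu setT (~` A))//; last exact: measurableC.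
rewrite setDE setTI setCK.
have /countable_injP[g ginj] := cA.
(* The fibres of the injection [g] cut [A] into pieces with at most one point each, turning the
   integral over [A] into a series. *)
pose F k : set (measurableTypeR R) := A `&` [set t | g t = k].
have FE k : F k = set0 \/ exists2 t, A t /\ g t = k & F k = [set t].
  have [->|/set0P[t [At gt]]] := eqVneq (F k) set0; first by left.
  right; exists t => //; apply/seteqP; split=> [u [Au gu]|u ->]; last by split.
  by apply: ginj; rewrite ?inE//= gu.
have AE : A = \bigcup_k F k.
  by apply/seteqP; split=> [t At|t [k _ []]//]; exists (g t).
have mF k : measurable (F k) by have [->//|[t _ ->]] := FE k.
rewrite [X in integral _ X]AE ge0_integral_bigcup//; last 2 first.
- exact: measurable_funS mE.
- by move=> i j _ _ [t [[_ <-] [_ <-]]].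
apply: lime_le; first by apply: is_cvg_nneseries => n _ _; exact: integral_ge0.
apply: nearW => N.
(* The bound [g t < N] is carried only for the induction: it shows that the atom of index [N] is not
   yet listed. *)
suff [s [us sA _ ->]] : exists s : seq R, [/\ uniq s, forall t, t \in s -> A t,
    forall t, t \in s -> (g t < N)%N &
    (\sum_(0 <= k < N) \int[mu]_(t in F k) (f t)%:E =
      \sum_(t <- s) (f t)%:E * mu [set t])%E] by exact: sM.
elim: N => [|N [s [us sA sg sE]]].
  by exists [::]; split=> //; rewrite big_geq// big_nil.
rewrite big_nat_recr//= sE; have [->|[t [At gt] ->]] := FE N.
  exists s; split=> //; first by move=> t /sg /ltnW.
  by rewrite integral_set0 adde0.
exists (t :: s); split.
- by rewrite /= us andbT; apply/negP => /sg; rewrite gt ltnn.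
- by move=> u; rewrite in_cons => /orP[/eqP ->|/sA].
- by move=> u; rewrite in_cons => /orP[/eqP ->|/sg /ltnW]; rewrite ?gt.
- by rewrite big_cons integral_singleton addeC.
Qed.

End integrals_of_atomic_measures.

(** * From a unitary transform to an atomic Herglotz function *)

Section phi_derivable.
Context {R : realType} {I : countType}.
Local Notation Re := complex.Re.
Local Notation Im := complex.Im.
Local Notation normc := Normc.normc.
Variables (gamma : I -> R[i]) (v : I -> R).
Hypothesis adm : admissible gamma v.
Hypothesis gamma_real : forall n, Im (gamma n) = 0.
Local Notation phi := (phi gamma v).

Lemma kernel_bound z n : 0 < Im z -> normc (kernel gamma z n) <= (Im z)^-1.
Proof.
move=> z0; rewrite /kernel Normc.normcV lef_pV2 ?posrE//; last first.
  by rewrite normc_gt0// subr_eq0 eq_sym nonreal_neq// gt_eqF.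
apply: le_trans (Im_le_normc _).
by rewrite !ReImE gamma_real add0r normrN ler_norm.
Qed.

(** The resolvent identity turns the difference quotient into the pairing of the kernels at [z + h]
    and [z]. Applied once more, it shows that the error is [h] times a sum that stays bounded. *)
Lemma phi_derivable (z : R[i]) : 0 < Im z -> derivable (phi : R[i]^o -> R[i]^o) z 1.
Proof.
move=> z0; set y := Im z in z0.
have v0 n : 0 <= v n by case: adm => _ v0 _; exact: ltW.
have star_near u : 0 < Im u -> star gamma v u.
  by move=> u0; apply: nonreal_star => //; rewrite gt_eqF.
have sz := star_near z z0.
pose k := kernel gamma.
pose S := fsum (fun n => normc (k z n) ^+ 2 * v n).
have S0 : 0 <= S by apply: fsum_ge0 => n; rewrite mulr_ge0// sqr_ge0.
apply/cvg_ex; exists (cip v (k z) (k z)).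
apply/cvgrPdist_le => /= eps eps0.
have [e e0 ->] : exists2 e : R, 0 < e & eps = e%:C.
  case: eps eps0 => a b; rewrite ltcE/= => /andP[/eqP -> a0]; by exists a.
(* The first bound keeps [z + h] at height at least [y / 2], so its kernel is at most [2 / y]. The
   second one makes the error at most [e]: the 4 is this 2 times that of [normc_csum]. *)
pose d := Num.min (y / 2) (e / (4 * (S + 1) / y)).
have d0 : 0 < d.
  by rewrite lt_min !divr_gt0// mulr_gt0// ltr_wpDl.
have dC : (0 : R[i]) < d%:C by rewrite ltcR.
near=> h.
have h0 : h != 0 by near: h; exists 1 => //=.
have hd : normc h <= d.
  have : `|h| <= d%:C by near: h; exists d%:C => //= u /=; rewrite sub0r normrN => /ltW.
  by rewrite normcE lecR.
have hy : y / 2 <= Im (z + h).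
  have := Im_le_normc h; rewrite ler_norml => /andP[+ _].
  have : d <= y / 2 by rewrite ge_min lexx.
  by rewrite ImD -/y; move: hd; lra.
have su : star gamma v (z + h) by apply: star_near; apply: lt_le_trans hy; rewrite divr_gt0.
rewrite /= [_%:A]mulr1 [h + z]addrC (phi_diff adm gamma_real su sz) addrAC subrr add0r.
rewrite /GRing.scale/= mulKf//.
rewrite -csumB; [|exact: csummable_kernels..].
have kb n : normc (k z n * k z n * (v n)%:C * k (z + h) n) <=
    2 / y * (normc (k z n) ^+ 2 * v n).
  rewrite !Normc.normcM normcR ger0_norm// -expr2 mulrC ler_wpM2r//.
    by rewrite mulr_ge0// sqr_ge0.
  apply: le_trans (kernel_bound _ _) _; first by apply: lt_le_trans hy; rewrite divr_gt0.
  rewrite -[leRHS]invrK lef_pV2 ?posrE ?invf_div ?divr_gt0//.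
  by apply: lt_le_trans hy; rewrite divr_gt0.
have kS := summable_kernel adm sz.
have sk : csummable (fun n => k z n * k z n * (v n)%:C * k (z + h) n).
  exact: csummable_dom kb (rsummableZ (2 / y) kS).
have -> : (fun n => k z n * k z n * (v n)%:C - k (z + h) n * k z n * (v n)%:C) =
    (fun n => - h * (k z n * k z n * (v n)%:C * k (z + h) n)).
  apply/funext => n; have := resolvent n su sz; rewrite -/k addrAC subrr add0r => hn.
  have -> : k z n * k z n * (v n)%:C - k (z + h) n * k z n * (v n)%:C =
      - (k (z + h) n - k z n) * (k z n * (v n)%:C) by ring.
  by rewrite hn; ring.
rewrite csumZ// normrM normrN !normcE -rmorphM lecR.
have le1 : normc (csum (fun n => k z n * k z n * (v n)%:C * k (z + h) n)) <= 4 * (S + 1) / y.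
  apply: le_trans (normc_csum sk) _.
  apply: (@le_trans _ _ (2 * (2 / y * S))).
    rewrite ler_pM2l// -fsumZ//; apply: le_fsum => //.
    exact: rsummableZ.
  have -> : 2 * (2 / y * S) = (4 * S) / y by ring.
  by rewrite ler_wpM2r ?invr_ge0 ?ltW//; lra.
have de : d <= e / (4 * (S + 1) / y) by rewrite ge_min lexx orbT.
apply: le_trans (ler_pM (normc_ge0 _) (normc_ge0 _) (le_trans hd de) le1) _.
by rewrite divfK// gt_eqF// divr_gt0// mulr_gt0// ltr_wpDl.
Unshelve. all: by end_near. Qed.

End phi_derivable.

Section poisson_kernel.
Context {R : realType}.
Local Notation Re := complex.Re.
Local Notation Im := complex.Im.
Implicit Types (t : measurableTypeR R) (z : R[i]).

Definition herglotz_kernel z (t : R) : R[i] := (t%:C - z)^-1 - (t / (1 + t ^+ 2))%:C.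

Lemma measurable_inv_quadratic (x c : R) : 0 < c ->
  measurable_fun setT (fun t => ((t - x) ^+ 2 + c)^-1).
Proof.
move=> c0; apply: continuous_measurable_fun => t.
apply: (@continuousV _ _ (fun t : R => (t - x) ^+ 2 + c)).
  by rewrite gt_eqF// ltr_wpDl// sqr_ge0.
apply: cvgD; last exact: cvg_cst.
by apply: cvgM; (apply: cvgB; [exact: cvg_id|exact: cvg_cst]).
Qed.

(** The last factor is left as [((t - 0) ^+ 2 + 1)^-1] to match [measurable_inv_quadratic]. *)
Lemma Re_herglotz_kernel z t : Re (herglotz_kernel z t) =
  (t - Re z) * ((t - Re z) ^+ 2 + Im z ^+ 2)^-1 - t * ((t - 0) ^+ 2 + 1)^-1.
Proof.
by rewrite !ReImE ReV sqr_normc !ReImE/= sub0r sqrrN subr0 [1 + _]addrC.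
Qed.

Lemma Im_herglotz_kernel z t : Im (herglotz_kernel z t) =
  Im z * ((t - Re z) ^+ 2 + Im z ^+ 2)^-1.
Proof. by rewrite !ReImE ImV sqr_normc !ReImE/= sub0r sqrrN oppr0 addr0 opprK. Qed.

Lemma measurable_Re_herglotz_kernel z : Im z != 0 ->
  measurable_fun setT (fun t => Re (herglotz_kernel z t)).
Proof.
move=> z0; have y0 : 0 < Im z ^+ 2 by rewrite exprn_even_gt0.
under eq_fun do rewrite Re_herglotz_kernel.
apply: measurable_funB; apply: measurable_funM => //.
- by apply: measurable_funB.
- exact: measurable_inv_quadratic.
- exact: measurable_inv_quadratic.
Qed.

Lemma measurable_Im_herglotz_kernel z : Im z != 0 ->
  measurable_fun setT (fun t => Im (herglotz_kernel z t)).
Proof.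
move=> z0; have y0 : 0 < Im z ^+ 2 by rewrite exprn_even_gt0.
under eq_fun do rewrite Im_herglotz_kernel.
by apply: measurable_funM => //; exact: measurable_inv_quadratic.
Qed.

End poisson_kernel.

(** * The transform of the kernels and the expansion of psi over Lambda(alpha) *)

Section lambda_family.
Context {R : realType} {I : countType}.
Local Notation Re := complex.Re.
Local Notation Im := complex.Im.
Local Notation normc := Normc.normc.
Variables (gamma : I -> R[i]) (v : I -> R) (alpha : R).
Hypothesis I_nonempty : [set: I] !=set0.
Hypothesis adm : admissible gamma v.
Hypothesis gamma_real : forall n, Im (gamma n) = 0.
Implicit Types (z u : R[i]).

Local Notation star := (star gamma v).
Local Notation phi := (phi gamma v).
Local Notation Lam := (Lambda gamma v alpha).
Local Notation T := (dht gamma v (L := Lam)).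
Local Notation K := (kernel gamma).
Local Notation e := (@lamvec R I gamma v alpha).
Local Notation psi := (fun z => (alpha%:C - phi z)^-1).

Let w (l : Lam) := weight gamma v (\val l).
Let v_gt0 n : 0 < v n. Proof. by case: adm. Qed.
Let v0 n : 0 <= v n. Proof. exact: ltW. Qed.
Let w_gt0 l : 0 < w l. Proof. exact: weight_gt0. Qed.
Let w0 l : 0 <= w l. Proof. exact: ltW. Qed.

Lemma Im_denom z : Im (alpha%:C - phi z) = - Im (phi z).
Proof. by rewrite !ReImE/= sub0r. Qed.

Lemma denom_neq0 z : Im z != 0 -> alpha%:C - phi z != 0.
Proof.
move=> z0; have sz := nonreal_star adm gamma_real z0.
suff : Im (alpha%:C - phi z) != 0 by apply: contraNneq => ->.
rewrite Im_denom oppr_eq0 Im_phi// mulf_neq0//.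
by rewrite gt_eqF// cip_kernel_gt0.
Qed.

(** No unitarity is assumed, so the right side of the theorem is really a condition on the
    representation. The converse reuses the positivity of Im psi. *)
Lemma herglotz_psi : herglotz psi.
Proof.
split=> z z0.
  apply: derivableV; first by apply: denom_neq0; rewrite gt_eqF.
  have d := phi_derivable adm gamma_real z0.
  exact: (@derivableB R[i] R[i]^o R[i]^o (cst alpha%:C) phi z 1 (derivable_cst _ _ _) d).
have zn : Im z != 0 by rewrite gt_eqF.
rewrite ImV Im_denom opprK Im_phi//; last exact: nonreal_star.
rewrite !mulr_gt0// ?invr_gt0 ?exprn_gt0// ?cip_kernel_gt0 ?normc_gt0 ?denom_neq0//.
exact: nonreal_star.
Qed.

Lemma lam_complex (l : Lam) : \val l = (Re (\val l))%:C.
Proof.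
apply: complex_ext => //=; apply: (Lambda_real I_nonempty adm gamma_real).
exact: set_valP.
Qed.

Lemma lam_neq z (l : Lam) : Im z != 0 -> z != \val l.
Proof. by apply: contraNneq => ->; rewrite lam_complex. Qed.

Let T_parts a : T a = fun l =>
  coef v e (fun n => Re (a n)) l +i* coef v e (fun n => Im (a n)) l.
Proof. exact: dht_parts. Qed.

Lemma dht_l2 a : l2 v a -> l2 w (T a).
Proof.
apply: (T_l2 v_gt0 w_gt0 _ _ _ T_parts).
- by move=> l; exact: lamvec_l2.
- by move=> l l'; exact: lamvec_orth.
- by move=> l; exact: lamvec_norm.
Qed.

Lemma dht_unitaryP : unitary v w T <->
  forall a, rl2 v a -> ip w (coef v e a) (coef v e a) = ip v a a.
Proof.
apply: (unitaryP v_gt0 w_gt0 _ _ _ T_parts).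
- by move=> l; exact: lamvec_l2.
- by move=> l l'; exact: lamvec_orth.
- by move=> l; exact: lamvec_norm.
Qed.

Section forward.
Hypothesis iso : forall a, rl2 v a -> ip w (coef v e a) (coef v e a) = ip v a a.

Lemma cip_dht a b : l2 v a -> l2 v b -> cip w (T a) (T b) = cip v a b.
Proof.
move=> la lb; have := cip_parts w0 (dht_l2 la) (dht_l2 lb).
rewrite (cip_parts v0 la lb) !T_parts /= => ->.
have [lar lai] := (l2_parts v0 a).1 la; have [lbr lbi] := (l2_parts v0 b).1 lb.
have pol : forall a g, rl2 v a -> rl2 v g -> ip w (coef v e a) (coef v e g) = ip v a g.
  apply: coef_polarized => //.
  - by move=> l; exact: lamvec_l2.
  - by move=> l l'; exact: lamvec_orth.
  - by move=> l; exact: lamvec_norm.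
by rewrite !pol.
Qed.

Definition lam_kernel_at z (l : Lam) : R[i] := (z - \val l)^-1.

Lemma dht_lam_kernel z : Im z != 0 ->
  T (K z) = fun l => (alpha%:C - phi z) * lam_kernel_at z l.
Proof.
move=> z0; apply/funext => l.
have sz := nonreal_star adm gamma_real z0.
by rewrite (dht_kernel adm gamma_real)// lam_neq.
Qed.

Lemma lam_kernel_l2 z : Im z != 0 -> l2 w (lam_kernel_at z).
Proof.
move=> z0; have d0 := denom_neq0 z0.
have sz := nonreal_star adm gamma_real z0.
apply/(l2P w0); have /(l2P w0) := dht_l2 (l2_kernel sz).
move=> /(rsummableZ ((normc (alpha%:C - phi z) ^+ 2)^-1)); congr rsummable.
apply/funext => l; rewrite dht_lam_kernel// Normc.normcM.
have := normc_gt0 d0; move: (normc (_ - _)) => c c0.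
by field; rewrite gt_eqF.
Qed.

(** The resolvent identity of [phi], transported by Parseval and divided by
    [(alpha - phi z) * (alpha - phi u)], becomes one for [psi] over Lambda(alpha) with the weights
    [w]. *)
Lemma psi_diff z u : Im z != 0 -> Im u != 0 ->
  psi z - psi u = (z - u) * cip w (lam_kernel_at z) (lam_kernel_at u).
Proof.
move=> z0 u0; have [az au] := (denom_neq0 z0, denom_neq0 u0).
have [sz su] := (nonreal_star adm gamma_real z0, nonreal_star adm gamma_real u0).
have := phi_diff adm gamma_real sz su.
rewrite -cip_dht; [|exact: l2_kernel..].
rewrite (_ : cip w (T (K z)) (T (K u)) = (alpha%:C - phi z) * (alpha%:C - phi u) *
  cip w (lam_kernel_at z) (lam_kernel_at u)); last first.
  rewrite !dht_lam_kernel// -csumZ; last by apply: csummable_cip => //; exact: lam_kernel_l2.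
  by congr csum; apply/funext => l; ring.
move: (cip w _ _) => C hC.
have -> : psi z - psi u = (phi z - phi u) / ((alpha%:C - phi z) * (alpha%:C - phi u)).
  move: az au; move: (alpha%:C) (phi z) (phi u) => a p q az au /=.
  by field; rewrite az au.
by rewrite hC [_ * C]mulrC mulrA mulfK// mulf_neq0.
Qed.

Let x (l : Lam) : measurableTypeR R := Re (\val l).
Let ci : R[i] := 0 +i* 1.

(** Since |i - x|^-2 = 1 / (1 + x^2), this is the square summability of [lam_kernel_at] at i. *)
Lemma summable_lam_weights : rsummable (fun l => (1 + x l ^+ 2)^-1 * w l).
Proof.
have i0 : Im ci != 0 by rewrite /= oner_eq0.
have /(l2P w0) := lam_kernel_l2 i0; congr rsummable; apply/funext => l.
rewrite /lam_kernel_at Normc.normcV exprVn sqr_normc [\val l]lam_complex !ReImE/=.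
by rewrite sub0r sqrrN oppr0 addr0 expr1n addrC.
Qed.

Lemma psi_expansion : exists b : R, forall z, Im z != 0 ->
  csummable (fun l => herglotz_kernel z (x l) * (w l)%:C) /\
  psi z = b%:C + csum (fun l => herglotz_kernel z (x l) * (w l)%:C).
Proof.
have i0 : Im ci != 0 by rewrite /= oner_eq0.
have Ni0 : Im (- ci) != 0 by rewrite /= oppr_eq0 oner_eq0.
pose S := fsum (fun l => (1 + x l ^+ 2)^-1 * w l).
have sS := summable_lam_weights.
have sSc : csummable (fun l => ((1 + x l ^+ 2)^-1 * w l)%:C).
  by apply: csummable_dom (rsummable_abs sS) => l; rewrite normcR.
have lE z l : z - \val l = z - (x l)%:C by rewrite {1}lam_complex.
have x1 l : 1 + x l ^+ 2 != 0 by rewrite gt_eqF// ltr_pwDl// sqr_ge0.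
have x1E l : (1 + x l ^+ 2)%:C = (ci - (x l)%:C) * (- ci - (x l)%:C).
  by apply: complex_ext; rewrite !ReImE/=; ring.
have wE l : ((1 + x l ^+ 2)^-1 * w l)%:C =
    (ci - (x l)%:C)^-1 * (- ci - (x l)%:C)^-1 * (w l)%:C.
  transitivity ((((1 + x l ^+ 2)%:C)^-1) * (w l)%:C); last by rewrite x1E invfM.
  by rewrite -fmorphV -rmorphM.
have CS : cip w (lam_kernel_at ci) (lam_kernel_at (- ci)) = S%:C.
  rewrite -csum_real; congr csum; apply/funext => l.
  by rewrite wE /lam_kernel_at !lE.
pose P := psi (- ci).
(* By symmetry psi(i) is the conjugate of psi(-i), and [psi_diff] at i and -i gives 2 i S as their
   difference. Hence P = Re P - i S, which makes b = Re P the right constant. *)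
have PS : Im P + S = 0.
  have := psi_diff i0 Ni0; rewrite CS opprK -/P.
  have -> : psi ci = P^*.
    have -> : ci = (- ci)^* by apply: complex_ext; rewrite ?Re_conj ?Im_conj/= ?oppr0 ?opprK.
    rewrite /P (phi_conj adm gamma_real (nonreal_star adm gamma_real Ni0)).
    rewrite conjc_inv; congr (_^-1).
    by apply: complex_ext; rewrite ?Re_conj ?Im_conj !ReImE ?Re_conj ?Im_conj/=; ring.
  move=> /(congr1 (@complex.Im R)); rewrite !ReImE Im_conj/=; lra.
exists (Re P) => z z0.
have zx l : z - (x l)%:C != 0 by rewrite -lE subr_eq0 lam_neq.
have cx l : ci - (x l)%:C != 0 by rewrite -lE subr_eq0 lam_neq.
have ncx l : - ci - (x l)%:C != 0 by rewrite -lE subr_eq0 lam_neq.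
have sz := csummable_cip w0 (lam_kernel_l2 z0) (lam_kernel_l2 Ni0).
(* Partial fractions at the base point -i: (1 + t z) / ((t - z) (1 + t^2)) is split into a product
   of two kernels, as in [psi_diff], and a multiple of 1 / (1 + t^2). *)
have kE l : herglotz_kernel z (x l) * (w l)%:C =
    (z + ci) * (lam_kernel_at z l * lam_kernel_at (- ci) l * (w l)%:C)
    + - ci * ((1 + x l ^+ 2)^-1 * w l)%:C.
  rewrite wE /herglotz_kernel /lam_kernel_at !lE.
  have -> : (x l / (1 + x l ^+ 2))%:C = (x l)%:C / ((ci - (x l)%:C) * (- ci - (x l)%:C)).
    by rewrite -x1E -fmorphV -rmorphM.
  move: (zx l) (cx l) (ncx l) => h1 h2 h3.
  move: h1 h2 h3; move: ((x l)%:C) ((w l)%:C) ci => X W c h1 h2 h3.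
  by field; rewrite h1 h2 h3 -opprB oppr_eq0.
have ks := csummableD (csummableZ (z + ci) sz) (csummableZ (- ci) sSc).
have -> : (fun l => herglotz_kernel z (x l) * (w l)%:C) = _ := funext kE.
split=> //; rewrite csumD ?csumZ//; [|exact: csummableZ..].
rewrite csum_real -/S -/(cip _ _ _).
have := psi_diff z0 Ni0; rewrite opprK -/P => <-.
have -> : (Re P)%:C = P + ci * S%:C.
  by move: PS; move: (P) (S) => p s ps; apply: complex_ext; rewrite !ReImE/=; lra.
ring.
Qed.

Lemma purely_atomic_psi : purely_atomic_herglotz psi.
Proof.
split; first exact: herglotz_psi.
have sS := summable_lam_weights.
have cJ : countable [set: Lam].
  apply: rsummable_countable sS => l.
  by rewrite mulr_gt0// invr_gt0 ltr_pwDl// sqr_ge0.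
have [mu muE] := atomic_measureP x w0 cJ.
have [b bE] := psi_expansion.
exists b, 0, mu; split=> //; last exact: atomic_purely muE.
split=> //.
- rewrite (muE (fun t => (1 + t ^+ 2)^-1)).
  + by rewrite -ge0_rsummable// => l; rewrite mulr_ge0// invr_ge0 addr_ge0// sqr_ge0.
  + rewrite (_ : (fun t => _) = fun t : measurableTypeR R => ((t - 0) ^+ 2 + 1)^-1).
      exact: measurable_inv_quadratic.
    by apply/funext => t; rewrite subr0 addrC.
  + by move=> t; rewrite invr_ge0 addr_ge0// sqr_ge0.
- move=> z zu; have z0 : Im z != 0 by rewrite gt_eqF.
  have [ks ->] := bE z z0; rewrite mul0r addr0; congr (_ + _).
  apply: complex_ext; rewrite /cintegral/=.
  + rewrite (atomic_Rintegral w0 muE (measurable_Re_herglotz_kernel z0)).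
      by congr fsum; apply/funext => l; rewrite ReM/= mulr0 subr0.
    have := csummable_Re ks; congr rsummable; apply/funext => l.
    by rewrite ReM/= mulr0 subr0.
  + rewrite (atomic_Rintegral w0 muE (measurable_Im_herglotz_kernel z0)).
      by congr fsum; apply/funext => l; rewrite ImM/= mulr0 add0r.
    have := csummable_Im ks; congr rsummable; apply/funext => l.
    by rewrite ImM/= mulr0 add0r.
Qed.

End forward.

End lambda_family.

(** * From an atomic Herglotz function to a unitary transform *)

Section backward.
Context {R : realType} {I : countType}.
Local Notation Re := complex.Re.
Local Notation Im := complex.Im.
Local Notation normc := Normc.normc.
Variables (gamma : I -> R[i]) (v : I -> R) (alpha : R).
Hypothesis I_nonempty : [set: I] !=set0.
Hypothesis adm : admissible gamma v.
Hypothesis gamma_real : forall n, Im (gamma n) = 0.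
Implicit Types (z u : R[i]).

Local Notation star := (star gamma v).
Local Notation phi := (phi gamma v).
Local Notation Lam := (Lambda gamma v alpha).
Local Notation T := (dht gamma v (L := Lam)).
Local Notation K := (kernel gamma).
Local Notation e := (@lamvec R I gamma v alpha).
Local Notation psi := (fun z => (alpha%:C - phi z)^-1).

Let w (l : Lam) := weight gamma v (\val l).
Let v_gt0 n : 0 < v n. Proof. by case: adm. Qed.
Let v0 n : 0 <= v n. Proof. exact: ltW. Qed.
Let w_gt0 l : 0 < w l. Proof. exact: weight_gt0. Qed.
Let w0 l : 0 <= w l. Proof. exact: ltW. Qed.

Lemma kernel_at_gamma (n m : I) (y : R) : y != 0 ->
  y * Im (K (Re (gamma n) +i* y) m) =
  y ^+ 2 / ((Re (gamma m) - Re (gamma n)) ^+ 2 + y ^+ 2).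
Proof.
move=> y0; rewrite /kernel ImV sqr_normc !ReImE/= gamma_real sub0r sqrrN opprK.
by rewrite mulrA expr2.
Qed.

(** The vector has entries y^2 / ((gamma_m - gamma_n)^2 + y^2), which tend to the indicator of [n].
    The proof is dominated convergence by hand: a summable majorant controls the tail, and a small
    [y] the remaining finite set. *)
Lemma delta_approx (n : I) (eps : R) : 0 < eps -> exists2 y : R, 0 < y &
  ip v (fun m => (m == n)%:R - y * Im (K (Re (gamma n) +i* y) m))
       (fun m => (m == n)%:R - y * Im (K (Re (gamma n) +i* y) m)) <= eps.
Proof.
move=> eps0; pose d m := Re (gamma m) - Re (gamma n).
have [ginj _ _] := adm.
have d0 m : m != n -> d m ^+ 2 != 0.
  move=> mn; rewrite sqrf_eq0 subr_eq0; apply: contra mn => /eqP gmn.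
  by apply/eqP/ginj/complex_ext; rewrite ?gamma_real.
have s1 : star (Re (gamma n) +i* 1) by apply: nonreal_star => //=; rewrite oner_eq0.
have h1E m : normc (K (Re (gamma n) +i* 1) m) ^+ 2 * v m = v m / (d m ^+ 2 + 1).
  rewrite /kernel Normc.normcV exprVn sqr_normc !ReImE/= gamma_real sub0r sqrrN.
  by rewrite expr1n mulrC.
have h1 : rsummable (fun m => v m / (d m ^+ 2 + 1)).
  by have := summable_kernel adm s1; congr rsummable; apply/funext.
have p1 m : 0 < d m ^+ 2 + 1 by rewrite ltr_wpDl// sqr_ge0.
have [s us tl] := fsum_tail h1 (divr_gt0 eps0 (ltr0n _ 2)).
(* At [m = n] the division by zero yields [c n = 0], consistent with the error vanishing there. *)
pose c m := v m / (d m ^+ 2) ^+ 2.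
pose C := \sum_(m <- s) c m.
have c0 m : 0 <= c m by rewrite divr_ge0// sqr_ge0.
have C0 : 0 <= C by apply: sumr_ge0.
pose y := Num.min 1 (eps / 2 / (C + 1)).
have y0 : 0 < y by rewrite lt_min ltr01 !divr_gt0// ltr_wpDl.
have y1 : y <= 1 by rewrite ge_min lexx.
have y2 : y ^+ 2 <= y by rewrite expr2 ger_pMr.
have yC : y * C <= eps / 2.
  apply: (@le_trans _ _ (eps / 2 / (C + 1) * C)).
    by rewrite ler_wpM2r// ge_min lexx orbT.
  rewrite -mulrA ger_pMr ?divr_gt0// mulrC ler_pdivrMr ?ltr_wpDl// mul1r lerDl//.
exists y => //.
pose q m := (m == n)%:R - y * Im (K (Re (gamma n) +i* y) m).
have qE m : q m = if m == n then 0 else - (y ^+ 2 / (d m ^+ 2 + y ^+ 2)).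
  rewrite /q kernel_at_gamma ?gt_eqF// -/(d m); case: eqVneq => [->|_]; last by rewrite sub0r.
  by rewrite /d subrr expr0n add0r divff ?subrr// expf_neq0// gt_eqF.
(* On [s] the squared error is at most y^4 / d^4 <= y / d^4; off [s] it is at most 1 / (d^2 + 1), as
   [y <= 1]. *)
pose F m := y * (if m \in s then c m else 0) + (if m \in s then 0 else `|v m / (d m ^+ 2 + 1)|).
have [ss sE] := fsum_seq c us.
have st : rsummable (fun m => if m \in s then 0 else `|v m / (d m ^+ 2 + 1)|).
  by apply: rsummable_dom (rsummable_abs h1) => m; case: ifP; rewrite ?normr0 ?normr_id.
have qF m : q m * q m * v m <= F m.
  rewrite qE /F; case: eqVneq => [_|mn].
    rewrite !mul0r; case: ifP => _; first by rewrite addr0 mulr_ge0// ltW.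
    by rewrite mulr0 add0r.
  have dm0 : 0 < d m ^+ 2 by rewrite lt_def d0// sqr_ge0.
  have yy0 : 0 < y ^+ 2 by rewrite exprn_gt0.
  have dy0 : 0 < d m ^+ 2 + y ^+ 2 by rewrite addr_gt0.
  rewrite mulrNN; case: ifP => _.
    rewrite addr0 /c; have -> : y * (v m / (d m ^+ 2) ^+ 2) = y / (d m ^+ 2) ^+ 2 * v m.
      by rewrite mulrCA mulrC.
    rewrite ler_wpM2r// mulf_div -!expr2 ler_pM//.
    - by rewrite sqr_ge0.
    - by rewrite invr_ge0 sqr_ge0.
    - apply: (le_trans _ y2); rewrite [(y ^+ 2) ^+ 2]expr2 ger_pMr//.
      exact: (le_trans y2 y1).
    - rewrite lef_pV2 ?posrE ?(exprn_gt0 _ dm0) ?(exprn_gt0 _ dy0)//.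
      by apply: lerXn2r; rewrite ?nnegrE ?(ltW dm0) ?(ltW dy0)// lerDl sqr_ge0.
  rewrite mulr0 add0r ger0_norm; last by rewrite divr_ge0// ltW.
  have -> : v m / (d m ^+ 2 + 1) = (d m ^+ 2 + 1)^-1 * v m by rewrite mulrC.
  rewrite ler_wpM2r//.
  have q1 : y ^+ 2 / (d m ^+ 2 + y ^+ 2) <= 1 by rewrite ler_pdivrMr// mul1r lerDr ltW.
  have q0 : 0 <= y ^+ 2 / (d m ^+ 2 + y ^+ 2) by rewrite divr_ge0// ltW.
  apply: (@le_trans _ _ (y ^+ 2 / (d m ^+ 2 + y ^+ 2))); first by rewrite ler_piMl.
  rewrite ler_pdivrMr// mulrC ler_pdivlMr//.
  have : y ^+ 2 <= 1 by apply: le_trans y2 y1.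
  by move: dm0 yy0; nra.
have q_ge0 m : 0 <= q m * q m * v m by rewrite mulr_ge0// -expr2 sqr_ge0.
have sF : rsummable F by apply: rsummableD => //; exact: rsummableZ.
apply: (@le_trans _ _ (fsum F)).
  apply: le_fsum => //; apply: rsummable_dom sF => m.
  by rewrite (ger0_norm (q_ge0 m)); exact: qF.
rewrite fsumD//; last exact: rsummableZ.
by rewrite fsumZ// sE -/C; move: yC tl; lra.
Qed.

Lemma normc_kernel_real (t y : R) n :
  normc (K (t +i* y) n) ^+ 2 = ((t - Re (gamma n)) ^+ 2 + y ^+ 2)^-1.
Proof.
rewrite /kernel Normc.normcV exprVn sqr_normc !ReImE/= gamma_real sub0r sqrrN.
by rewrite -[X in X ^+ 2 + _]opprB sqrrN.
Qed.

(* [|Im (alpha - phi)| = y sum_n v_n / ((gamma_n - t)^2 + y^2)], so the bound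
   controls all partial sums at [y = 0]. *)
Lemma atom_in_Lambda (t M : R) : 0 < M ->
  (forall y, 0 < y -> normc (alpha%:C - phi (t +i* y)) <= y / M) ->
  exists2 l : Lam, Re (\val l) = t & M <= w l.
Proof.
move=> M0 hM.
have star_t y : 0 < y -> star (t +i* y).
  by move=> y0; apply: nonreal_star => //=; rewrite gt_eqF.
have QM y : 0 < y -> fsum (fun n => normc (K (t +i* y) n) ^+ 2 * v n) <= M^-1.
  move=> y0; rewrite -(ler_pM2l y0) -[y in y * fsum _]/(Im (t +i* y)).
  rewrite -Im_phi//; last exact: star_t.
  apply: le_trans (hM y y0); apply: le_trans (Im_le_normc _).
  by rewrite !ReImE/= sub0r normrN ler_norm.
have termM y n : 0 < y -> v n / ((t - Re (gamma n)) ^+ 2 + y ^+ 2) <= M^-1.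
  move=> y0; apply: le_trans (QM y y0).
  have := le_fsum_term n _ (summable_kernel adm (star_t y y0)).
  rewrite normc_kernel_real mulrC; apply => m.
  by rewrite mulr_ge0// sqr_ge0.
have tg n : t != Re (gamma n).
  (* If t were gamma_n, the n-th term v_n / y^2 would exceed 1 / M as soon as y^2 <= M v_n / 2. *)
  apply/eqP => tE; pose y := Num.min 1 (M * v n / 2).
  have y0 : 0 < y by rewrite lt_min ltr01 divr_gt0// mulr_gt0.
  have := termM y n y0; rewrite tE subrr expr0n add0r.
  rewrite ler_pdivrMr ?exprn_gt0// mulrC ler_pdivlMr//.
  have : y ^+ 2 <= M * v n / 2.
    apply: (@le_trans _ _ y); last by rewrite ge_min lexx orbT.
    by rewrite expr2 ger_pMr// ge_min lexx.
  by have := mulr_gt0 M0 (v_gt0 n); lra.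
have d0 n : 0 < (t - Re (gamma n)) ^+ 2 by rewrite exprn_even_gt0//= subr_eq0.
have [st0 Qt] : rsummable (fun n => v n / (t - Re (gamma n)) ^+ 2) /\
    fsum (fun n => v n / (t - Re (gamma n)) ^+ 2) <= M^-1.
  apply: ge0_rsummable_bound => [n|s us]; first by rewrite divr_ge0// ltW.
  (* From 1 / A <= 1 / (A + y^2) + y^2 / A^2: removing [y] from the denominators costs at most
     [y ^+ 2 * C] on a finite set. *)
  pose C := \sum_(n <- s) v n / ((t - Re (gamma n)) ^+ 2) ^+ 2.
  have C0 : 0 <= C by apply: sumr_ge0 => n _; rewrite divr_ge0// sqr_ge0.
  apply/ler_addgt0Pl => eps eps0.
  pose y := Num.min 1 (eps / (C + 1)).
  have y0 : 0 < y by rewrite lt_min ltr01 divr_gt0// ltr_wpDl.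
  have yC : y ^+ 2 * C <= eps.
    apply: (@le_trans _ _ (y * C)).
      by rewrite ler_wpM2r// expr2 ger_pMr// ge_min lexx.
    apply: (@le_trans _ _ (eps / (C + 1) * C)).
      by rewrite ler_wpM2r// ge_min lexx orbT.
    by rewrite -mulrA ger_pMr// mulrC ler_pdivrMr ?ltr_wpDl// mul1r lerDl.
  apply: le_trans _ (lerD yC (QM y y0)).
  have := sum_le_fsum _ (summable_kernel adm (star_t y y0)) us.
  move=> /(_ (fun n => mulr_ge0 (sqr_ge0 _) (v0 n))) sQ.
  apply: le_trans _ (lerD (lexx _) sQ); rewrite mulr_sumr -big_split/=.
  apply: ler_sum => n _; rewrite normc_kernel_real.
  have := d0 n; move: ((t - Re (gamma n)) ^+ 2) => A A0.
  have yy0 : 0 < y ^+ 2 by rewrite exprn_gt0.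
  move: (y ^+ 2) yy0 => B B0.
  have -> : B * (v n / A ^+ 2) + (A + B)^-1 * v n = (B / A ^+ 2 + (A + B)^-1) * v n by ring.
  rewrite mulrC ler_wpM2r// -subr_ge0.
  have -> : B / A ^+ 2 + (A + B)^-1 - A^-1 = B ^+ 2 / (A ^+ 2 * (A + B)).
    by field; rewrite !gt_eqF// addr_gt0.
  by rewrite divr_ge0 ?sqr_ge0// mulr_ge0 ?sqr_ge0// addr_ge0 ?ltW.
have kt n : normc (K t%:C n) ^+ 2 * v n = v n / (t - Re (gamma n)) ^+ 2.
  by rewrite normc_kernel_real expr0n addr0 mulrC.
have st : star t%:C.
  split=> [n|].
    by apply: contra_neq (tg n) => /(congr1 (@complex.Re R)).
  rewrite -ge0_rsummable => [|n]; last by rewrite divr_ge0// sqr_ge0.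
  move: st0; congr rsummable; apply/funext => n; congr (_ / _).
  by rewrite sqr_normc !ReImE/= gamma_real subr0 expr0n addr0.
have phit : phi t%:C = alpha%:C.
  (* One third of the constant is the hypothesis [hM]; the other two come from the resolvent
     identity, Young's inequality and the bounds [QM] and [Qt]. *)
  have bnd y : 0 < y -> normc (alpha%:C - phi t%:C) <= y * (3 / M).
    move=> y0; have sy := star_t y y0.
    have -> : alpha%:C - phi t%:C = (alpha%:C - phi (t +i* y)) + (phi (t +i* y) - phi t%:C).
      by rewrite addrA subrK.
    apply: le_trans (le_normcD _ _) _.
    rewrite (phi_diff adm gamma_real sy st) Normc.normcM.
    have -> : normc (t +i* y - t%:C) = y.
      by rewrite /= subrr subr0 expr0n add0r sqrtr_sqr ger0_norm// ltW.
    have sk := csummable_kernels adm sy st.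
    have := normc_csum sk.
    have : 2 * fsum (fun n => normc (K (t +i* y) n * K t%:C n * (v n)%:C)) <= M^-1 + M^-1.
      apply: le_trans _ (lerD (QM y y0) Qt).
      have s1 := summable_kernel adm sy; have s2 := summable_kernel adm st.
      rewrite -(funext kt) -fsumZ// -fsumD//; apply: le_fsum.
      - exact: rsummableZ.
      - exact: rsummableD.
      move=> n; rewrite !Normc.normcM normcR ger0_norm// -mulrDl mulrA ler_wpM2r//.
      have := sqr_ge0 (normc (K (t +i* y) n) - normc (K t%:C n)).
      by move: (normc _) (normc _) => a b; nra.
    move=> h1 h2; have h3 := le_trans h2 h1.
    have := hM y y0; have := ler_wpM2l (ltW y0) h3; rewrite -/(cip _ _ _).
    move: (normc _) (y * normc _) => a b; lra.
  apply/eqP; rewrite eq_sym -subr_eq0; apply/eqP/Normc.eq0_normc/eqP.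
  rewrite eq_le normc_ge0 andbT; apply/ler_addgt0Pl => eps eps0; rewrite addr0.
  have M3 : 0 < 3 / M by rewrite divr_gt0.
  by apply: le_trans (bnd (eps / (3 / M)) _) _; rewrite ?divr_gt0// divfK// gt_eqF.
have tL : t%:C \in Lam by rewrite inE; split.
pose l : Lam := SigSub tL; exists l => //.
have wE := lamvec_norm I_nonempty adm gamma_real l.
rewrite -[M]invrK -[w l]invrK -wE lef_pV2 ?posrE ?invr_gt0//; last first.
  by rewrite wE invr_gt0; exact: w_gt0.
apply: le_trans Qt; rewrite le_eqVlt; apply/orP; left; apply/eqP.
congr fsum; apply/funext => n; rewrite /lamvec/= mulrC.
by rewrite -invfM expr2.
Qed.

Section from_representation.
Variables (b : R) (mu : {measure set (measurableTypeR R) -> \bar R}).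
Hypothesis psi_repr : forall z, upper z ->
  psi z = b%:C + (0 : R)%:C * z + cintegral mu (herglotz_kernel z).
Hypothesis mu_atomic : purely_atomic_measure mu.

Let P z (t : measurableTypeR R) := Im (herglotz_kernel z t).

Lemma Im_herglotz_kernel_ge0 z t : 0 < Im z -> 0 <= P z t.
Proof.
move=> z0; rewrite /P Im_herglotz_kernel mulr_ge0 ?ltW// invr_gt0.
by rewrite ltr_wpDl ?sqr_ge0// exprn_gt0.
Qed.

Lemma Im_psi z : 0 < Im z -> 0 < Im (psi z) /\
  (\int[mu]_t (P z t)%:E = (Im (psi z))%:E)%E.
Proof.
move=> z0; have [_ /(_ z z0) Im0] := herglotz_psi alpha I_nonempty adm gamma_real.
split=> //; have imE : Im (psi z) = fine (\int[mu]_t (P z t)%:E).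
  by rewrite psi_repr// !ReImE/= !mul0r !add0r.
(* [fine] sends infinite values to 0, so the strict positivity of Im psi forces the integral to be
   finite. *)
rewrite imE; move: Im0; rewrite imE.
by case: (\int[mu]_t _)%E => //=; rewrite ltxx.
Qed.

(** At its centre the Poisson kernel equals 1 / y, so an atom of mass m at t gives m / y <= Im psi
    <= 1 / |alpha - phi| at t + iy. *)
Lemma atom_weight t : mu [set t] != 0%E ->
  exists2 l : Lam, Re (\val l) = t & (mu [set t] <= (w l)%:E)%E.
Proof.
move=> m0.
have key (y : R) : 0 < y -> ((y^-1)%:E * mu [set t] <= (Im (psi (t +i* y)))%:E)%E.
  move=> y0; have [_ <-] := Im_psi (z := t +i* y) y0.
  have -> : y^-1 = P (t +i* y) t.
    by rewrite /P Im_herglotz_kernel/= subrr expr0n add0r; field; rewrite gt_eqF.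
  apply: atom_le_integral.
    by apply: measurable_Im_herglotz_kernel; rewrite gt_eqF.
  by move=> u; exact: Im_herglotz_kernel_ge0.
have [M MU] : exists M : R, mu [set t] = M%:E.
  exists (fine (mu [set t])); rewrite fineK// ge0_fin_numE ?measure_ge0//.
  by have := key 1 ltr01; rewrite invr1 mul1e => /le_lt_trans; apply; rewrite ltry.
have M0 : 0 < M.
  have mge : (0 <= mu [set t])%E by exact: measure_ge0.
  rewrite lt_def; move: m0 mge; rewrite MU lee_fin => m0 ->.
  by rewrite andbT; apply: contra m0 => /eqP ->.
rewrite MU; have [y y0|l lt Ml] := @atom_in_Lambda t M M0; last by exists l; rewrite ?lee_fin.
have := key y y0; rewrite MU -EFinM lee_fin => h.
have z0 : Im (t +i* y) != 0 by rewrite gt_eqF.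
have d0 := normc_gt0 (denom_neq0 alpha I_nonempty adm gamma_real z0).
have := le_trans h (le_trans (ler_norm _) (Im_le_normc _)).
rewrite Normc.normcV -ler_pdivlMl ?invr_gt0// invrK => hh.
by rewrite ler_pdivlMr// mulrC; move: hh; rewrite ler_pdivlMr.
Qed.

Lemma Im_psi_le z : 0 < Im z ->
  ((Im (psi z))%:E <= \esum_(l in [set: Lam]) (P z (Re (\val l)) * w l)%:E)%E.
Proof.
move=> z0; have [_ <-] := Im_psi z0; have [A cA A0] := mu_atomic.
apply: (atomic_integral_le cA A0).
- by apply: measurable_Im_herglotz_kernel; rewrite gt_eqF.
- by move=> t; exact: Im_herglotz_kernel_ge0.
move=> s us _.
(* Points of zero mass are skipped and every other one is replaced by its point of Lambda(alpha).
   Keeping the real parts in [s] ensures that no point is listed twice. *)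
suff [s' [us' _ hs]] : exists s' : seq Lam, [/\ uniq s',
    forall l, l \in s' -> Re (\val l) \in s &
    (\sum_(t <- s) (P z t)%:E * mu [set t] <=
     \sum_(l <- s') (P z (Re (\val l)) * w l)%:E)%E].
  apply: le_trans hs _; apply: sum_le_esum => // l.
  by rewrite lee_fin mulr_ge0 ?Im_herglotz_kernel_ge0 ?ltW.
elim: s us => [_|t s ih /= /andP[ts /ih[s' [us' ss' hs]]]].
  by exists [::]; split=> //; rewrite !big_nil.
have [m0|/atom_weight[l lt ml]] := eqVneq (mu [set t]) 0%E.
  exists s'; split=> // [l /ss'|]; first by rewrite in_cons => ->; rewrite orbT.
  by rewrite big_cons m0 mule0 add0e.
exists (l :: s'); split.
- by rewrite /= us' andbT; apply/negP => /ss'; rewrite lt (negbTE ts).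
- by move=> l'; rewrite !in_cons => /orP[/eqP ->|/ss' ->]; rewrite ?lt ?eqxx ?orbT.
- rewrite !big_cons lt leeD// EFinM lee_wpmul2l// lee_fin; exact: Im_herglotz_kernel_ge0.
Qed.

Lemma representation_isometry a : rl2 v a ->
  ip w (coef v e a) (coef v e a) = ip v a a.
Proof.
have el := @lamvec_l2 R I gamma v alpha I_nonempty adm gamma_real.
have eo := @lamvec_orth R I gamma v alpha I_nonempty adm gamma_real.
have en := @lamvec_norm R I gamma v alpha I_nonempty adm gamma_real.
move: a; apply: (coef_isometry v_gt0 w_gt0 el eo en) => n eps eps0.
have [y y0 yeps] := delta_approx n eps0.
pose z : R[i] := Re (gamma n) +i* y.
have zp : 0 < Im z by [].
have z0 : Im z != 0 by rewrite gt_eqF.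
have sz : star z by exact: nonreal_star.
have [lr li] := (l2_parts v0 _).1 (l2_kernel sz).
exists (fun m => y * Im (K z m)); split=> //; first exact: rl2Z.
rewrite (defectZ v_gt0 w_gt0 el eo en)//.
suff -> : defect v w e (fun m => Im (K z m)) = 0 by rewrite mulr0.
have Dr := defect_ge0 v_gt0 w_gt0 el eo en lr.
have Di := defect_ge0 v_gt0 w_gt0 el eo en li.
(* Only the sum of the two defects is visible in the complex norm of the kernel; both being
   nonnegative, they vanish together. *)
suff : defect v w e (fun m => Re (K z m)) + defect v w e (fun m => Im (K z m)) <= 0.
  by move: Dr Di; move: (defect _ _ _ _) (defect _ _ _ _) => p q; lra.
pose Q := fsum (fun m => normc (K z m) ^+ 2 * v m).
have QE := fsum_sqr_normc v0 (l2_kernel sz); rewrite -/Q in QE.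
have lT := dht_l2 alpha I_nonempty adm gamma_real (l2_kernel sz).
pose QT := fsum (fun l : Lam => normc (T (K z) l) ^+ 2 * w l).
have QTE := fsum_sqr_normc w0 lT; rewrite -/QT in QTE.
have TE := dht_parts alpha I_nonempty adm gamma_real (K z).
rewrite (_ : (fun l => Re (T (K z) l)) = coef v e (fun m => Re (K z m))) in QTE;
  last by rewrite TE.
rewrite (_ : (fun l => Im (T (K z) l)) = coef v e (fun m => Im (K z m))) in QTE;
  last by rewrite TE.
suff : Q <= QT.
  rewrite /defect; move: QE QTE => -> ->; move: (ip v _ _) (ip v _ _) => p q.
  by move: (ip w _ _) (ip w _ _) => r s; lra.
have d0 := denom_neq0 alpha I_nonempty adm gamma_real z0.
have nd0 := normc_gt0 d0.
set d := normc (alpha%:C - phi z) in nd0.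
have dn0 : d != 0 by rewrite gt_eqF.
(* The common factor [y / d ^+ 2] also relates Im psi(z) to the square norm [Q] of the kernel, so
   [Im_psi_le] reduces to [Q <= QT]. *)
have PE (l : Lam) : P z (Re (\val l)) * w l = (y / d ^+ 2) * (normc (T (K z) l) ^+ 2 * w l).
  rewrite (dht_lam_kernel alpha I_nonempty adm gamma_real z0) Normc.normcM exprMn -/d.
  have -> : normc (lam_kernel_at z l) ^+ 2 = ((Re (\val l) - Re z) ^+ 2 + Im z ^+ 2)^-1.
    rewrite /lam_kernel_at Normc.normcV exprVn sqr_normc.
    rewrite [\val l](lam_complex I_nonempty adm gamma_real).
    by rewrite !ReImE/= oppr0 addr0 -[X in X ^+ 2 + _]opprB sqrrN.
  rewrite /P Im_herglotz_kernel [Im z]/=; move: (_^-1) => q.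
  by field.
have sT := (l2P w0 _).1 lT.
have := Im_psi_le zp.
rewrite (_ : (\esum_(l in _) _)%E = (y / d ^+ 2 * QT)%:E); last first.
  have yd0 : 0 <= y / d ^+ 2 by rewrite divr_ge0 ?sqr_ge0// ltW.
  rewrite -fsumZ// fsum_ge0E; last exact: rsummableZ.
    by apply: eq_esum => l _; rewrite PE.
  by move=> l; apply: mulr_ge0 => //; rewrite mulr_ge0 ?sqr_ge0.
rewrite lee_fin ImV (Im_denom gamma v alpha z) opprK Im_phi// -/d -/Q.
have -> : Im z * Q * d ^- 2 = y / d ^+ 2 * Q by rewrite mulrAC.
by rewrite ler_pM2l// divr_gt0// exprn_gt0.
Qed.

End from_representation.

End backward.

Theorem theorem2 (R : realType) (I : countType) (gamma : I -> R[i])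
    (v : I -> R) (alpha : R)
    (I_nonempty : [set: I] !=set0)
    (gamma_v_admissible : admissible gamma v)
    (gamma_real : forall n : I, complex.Im (gamma n) = 0) :
  unitary v
    (fun l : Lambda gamma v alpha => weight gamma v (\val l))
    (dht gamma v (L := Lambda gamma v alpha))
  <->
  purely_atomic_herglotz (fun z : R[i] => (alpha%:C - phi gamma v z)^-1).
Proof.
split=> [/dht_unitaryP iso|].
  exact: purely_atomic_psi (iso I_nonempty gamma_v_admissible gamma_real).
move=> [_ [b [c [mu [[_ _ repr] c0 atomic]]]]]; rewrite {}c0 in repr.
apply/dht_unitaryP => // a la.
exact: (representation_isometry I_nonempty gamma_v_admissible gamma_real repr atomic).
Qed.
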